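(* Let $f:\mathcal C\to\mathbb R^n$ be globally Lipschitz with $f(0)=0$, and let $\mathcal D:\mathcal C\to\mathbb R^n$, $\mathcal D\phi=\phi(0)-\sum_{j=1}^pA_j\phi(-\Delta_j)$, be strongly stable. Then the system described by $$\frac{d}{dt}\mathcal Dx_t=f(x_t),\quad t\ge 0,\qquad x(\tau)=\xi_0(\tau),\ \tau\in[-\Delta,0],\ \xi_0\in\mathcal C,$$ is $0$-GES if and only if there exist a globally Lipschitz functional $V:\mathcal C\to\mathbb R^+$, a semi-norm $\|\cdot\|_a$ on $\mathcal C$ and positive reals $a_1,a_2,a_3,a_4$ such that the following conditions hold for all $\phi\in\mathcal C$: (i) $a_1|\mathcal D\phi|\le V(\phi)\le a_2\|\phi\|_a$; (ii) $D^+V(\phi)\le-a_3\|\phi\|_a$; (iii) $\|\phi\|_a\le a_4\|\phi\|$.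
   Context: Notation. $\mathbb R^+=[0,+\infty)$; $|\cdot|$ is the Euclidean norm on $\mathbb R^n$; $n,p$ are positive integers; $\Delta>0$ is real; $0<\Delta_j\le\Delta$ are reals and $A_j\in\mathbb R^{n\times n}$, $j=1,\dots,p$. $\mathcal C$ is the Banach space of continuous functions $[-\Delta,0]\to\mathbb R^n$ with the supremum norm $\|\cdot\|$. For a function $x$ on $[-\Delta,c)$ and $t\in[0,c)$, $x_t\in\mathcal C$ is $x_t(\tau)=x(t+\tau)$, $\tau\in[-\Delta,0]$. A solution on $[0,b)$ is a continuous $x:[-\Delta,b)\to\mathbb R^n$ with $x_0=\xi_0$ such that $t\mapsto\mathcal Dx_t$ is continuously differentiable and satisfies the equation (one-sided derivative at $t=0$). Strong stability. $\mathcal D$ is strongly stable (Hale and Lunel) if for every choice of positive delays $r_1,\dots,r_p$ the zero solution of the difference equation $y(t)=\sum_{j=1}^pA_jy(t-r_j)$ is uniformly asymptotically stable; equivalently, $\sup\{\rho(\sum_{j=1}^pA_je^{i\theta_j}):\theta_j\in[0,2\pi]\}<1$, where $\rho$ is the spectral radius. Lipschitz notion. A map $Q$ on $\mathcal C$ is globally Lipschitz if there is $L>0$ with $|Q(\phi_1)-Q(\phi_2)|\le L\|\phi_1-\phi_2\|$ for all $\phi_1,\phi_2\in\mathcal C$. 0-GES. The system is $0$-GES if there exist positive reals $M,\lambda$ such that, for any $\xi_0\in\mathcal C$, the corresponding solution exists for all $t\in\mathbb R^+$ and satisfies $|x(t)|\le Me^{-\lambda t}\|\xi_0\|$ for all $t\ge0$.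 Derivative. For (locally) Lipschitz $V:\mathcal C\to\mathbb R^+$, $D^+V:\mathcal C\to[-\infty,+\infty]$ is $$D^+V(\phi)=\limsup_{h\to0^+}\frac{V(\phi_h)-V(\phi)}{h},$$ where, for $0<h<\Delta$, $\phi_h\in\mathcal C$ is given by $\phi_h(s)=\phi(s+h)$ for $s\in[-\Delta,-h]$ and $\phi_h(s)=\mathcal D\phi+f(\phi)(s+h)-\mathcal D\phi^\star_{s+h}+\phi(0)$ for $s\in(-h,0]$; and, for $0<\theta\le h$, $\phi^\star_\theta\in\mathcal C$ is given by $\phi^\star_\theta(s)=\phi(s+\theta)$ for $s\in[-\Delta,-\theta]$ and $\phi^\star_\theta(s)=\phi(0)$ for $s\in(-\theta,0]$. *)

(* Defs.v *)
From mathcomp Require Import all_boot all_order all_algebra.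
From mathcomp Require Import all_classical all_reals all_analysis.
Set Implicit Arguments.
Unset Strict Implicit.
Unset Printing Implicit Defensive.
Import Order.TTheory GRing.Theory Num.Theory.
Import numFieldNormedType.Exports.

Local Open Scope classical_set_scope.
Local Open Scope ring_scope.

(* The norm the library puts on 'cV[R]_n is the max norm; it is used below only
   through its topology, which is the Euclidean one. *)
Definition enorm (R : realType) (n : nat) (v : 'cV[R]_n) : R :=
  Num.sqrt (\sum_(i < n) v i ord0 ^+ 2).

(* An element of the space of continuous functions [-r, 0] -> R^n is given by a
   total function on R whose restriction to [-r, 0] is continuous; values
   outside [-r, 0] are junk.  Maps on this space take such total functions, and
   everything is required of them on [hist r] only.  A map that is globally
   Lipschitz there depends only on the restriction to [-r, 0], and so does a
   semi-norm bounded by a multiple of [hnorm r]. *)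
Definition hist (R : realType) (n : nat) (r : R) : set (R -> 'cV[R]_n) :=
  [set phi : R -> 'cV[R]_n | {within `[- r, 0], continuous phi}].

Definition hnorm (R : realType) (n : nat) (r : R) (phi : R -> 'cV[R]_n) : R :=
  sup [set enorm (phi tau) | tau in `[- r, 0]].

Definition seg (R : realType) (n : nat) (x : R -> 'cV[R]_n) (t : R) :
  R -> 'cV[R]_n := fun tau => x (t + tau).

Definition globally_lipschitz (R : realType) (n : nat) (r : R) (W : zmodType)
    (nrm : W -> R) (Q : (R -> 'cV[R]_n) -> W) : Prop :=
  exists2 L : R, 0 < L & forall phi1 phi2, hist r phi1 -> hist r phi2 ->
    nrm (Q phi1 - Q phi2) <= L * hnorm r (phi1 - phi2).

Definition seminorm_on_hist (R : realType) (n : nat) (r : R)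
    (N : (R -> 'cV[R]_n) -> R) : Prop :=
  [/\ forall phi, hist r phi -> 0 <= N phi,
      forall (c : R) phi, hist r phi -> N (c *: phi) = `|c| * N phi
    & forall phi psi, hist r phi -> hist r psi ->
        N (phi + psi) <= N phi + N psi].

Definition Dop (R : realType) (n p : nat) (A : 'I_p -> 'M[R]_n)
    (delay : 'I_p -> R) (phi : R -> 'cV[R]_n) : 'cV[R]_n :=
  phi 0 - \sum_(j < p) A j *m phi (- delay j).

(* y is a (continuous) solution on [t0 - max_j r_j, +oo) of
   y(t) = sum_j A_j y(t - r_j), t >= t0; the equation at t = t0 is the
   compatibility condition on the initial function. *)
Definition difference_solution (R : realType) (n p : nat)
    (A : 'I_p -> 'M[R]_n) (r : 'I_p -> R) (t0 : R) (y : R -> 'cV[R]_n) : Prop :=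
  {within `[t0 - \big[Num.max/0]_(j < p) r j, +oo[, continuous y} /\
  forall t, t0 <= t -> y t = \sum_(j < p) A j *m y (t - r j).

(* Uniform stability together with uniform attractivity. *)
Definition difference_UAS (R : realType) (n p : nat)
    (A : 'I_p -> 'M[R]_n) (r : 'I_p -> R) : Prop :=
  let rmax := \big[Num.max/0]_(j < p) r j in
  (forall eps : R, 0 < eps -> exists2 d : R, 0 < d &
     forall t0 y, 0 <= t0 -> difference_solution A r t0 y ->
       hnorm rmax (seg y t0) < d ->
       forall t, t0 <= t -> hnorm rmax (seg y t) < eps) /\
  (exists2 d0 : R, 0 < d0 & forall eta : R, 0 < eta -> exists2 T : R, 0 <= T &
     forall t0 y, 0 <= t0 -> difference_solution A r t0 y ->
       hnorm rmax (seg y t0) < d0 ->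
       forall t, t0 + T <= t -> hnorm rmax (seg y t) < eta).

Definition strongly_stable (R : realType) (n p : nat) (A : 'I_p -> 'M[R]_n) :
  Prop := forall r : 'I_p -> R, (forall j, 0 < r j) -> difference_UAS A r.

(* G has derivative l at t relative to the set S (one-sided at an endpoint). *)
Definition derivative_within (R : realType) (n : nat) (S : set R)
    (G : R -> 'cV[R]_n) (t : R) (l : 'cV[R]_n) : Prop :=
  (s - t)^-1 *: (G s - G t) @[s --> within S t^'] --> l.

Definition neutral_solution (R : realType) (n p : nat) (Delta : R)
    (A : 'I_p -> 'M[R]_n) (delay : 'I_p -> R)
    (f : (R -> 'cV[R]_n) -> 'cV[R]_n) (xi0 : R -> 'cV[R]_n)
    (b : \bar R) (x : R -> 'cV[R]_n) : Prop :=
  let J := [set t : R | 0 <= t /\ (t%:E < b)%E] in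
  [/\ {within [set t : R | - Delta <= t /\ (t%:E < b)%E], continuous x},
      forall tau, tau \in `[- Delta, 0] -> x tau = xi0 tau
    & exists g : R -> 'cV[R]_n,
        [/\ {within J, continuous g},
            forall t, J t ->
              derivative_within J (fun s => Dop A delay (seg x s)) t (g t)
          & forall t, J t -> g t = f (seg x t)]].

(* "The corresponding solution exists on [0, +oo) and satisfies the bound":
   a global solution exists, and the bound is asked of every global solution. *)
Definition zero_GES (R : realType) (n p : nat) (Delta : R)
    (A : 'I_p -> 'M[R]_n) (delay : 'I_p -> R)
    (f : (R -> 'cV[R]_n) -> 'cV[R]_n) : Prop :=
  exists M lambda : R, [/\ 0 < M, 0 < lambda &
    forall xi0, hist Delta xi0 ->
      (exists x, neutral_solution Delta A delay f xi0 +oo%E x) /\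
      (forall x, neutral_solution Delta A delay f xi0 +oo%E x ->
        forall t, 0 <= t ->
          enorm (x t) <= M * expR (- lambda * t) * hnorm Delta xi0)].

Definition phi_star (R : realType) (n : nat) (phi : R -> 'cV[R]_n) (theta : R) :
  R -> 'cV[R]_n := fun s => if s <= - theta then phi (s + theta) else phi 0.

Definition phi_ext (R : realType) (n p : nat) (A : 'I_p -> 'M[R]_n)
    (delay : 'I_p -> R) (f : (R -> 'cV[R]_n) -> 'cV[R]_n)
    (phi : R -> 'cV[R]_n) (h : R) : R -> 'cV[R]_n :=
  fun s => if s <= - h then phi (s + h)
    else Dop A delay phi + (s + h) *: f phi
         - Dop A delay (phi_star phi (s + h)) + phi 0.

Definition Dplus (R : realType) (n p : nat) (A : 'I_p -> 'M[R]_n)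
    (delay : 'I_p -> R) (f : (R -> 'cV[R]_n) -> 'cV[R]_n)
    (V : (R -> 'cV[R]_n) -> R) (phi : R -> 'cV[R]_n) : \bar R :=
  limf_esup (fun h : R => ((V (phi_ext A delay f phi h) - V phi) / h)%:E) 0^'+.

(* Main.v *)
From HB Require Import structures.
Require Import Defs.
From mathcomp Require Import all_boot all_order all_algebra.
From mathcomp Require Import all_classical all_reals all_analysis.
From mathcomp Require Import ring lra.
Import Order.TTheory GRing.Theory Num.Theory.
Import numFieldNormedType.Exports.
Local Open Scope classical_set_scope.
Local Open Scope ring_scope.

(** Both directions rest on one computation.  If [x] solves the neutral
equation and [phi] is its history at time [t], then the history [h] later
differs from the explicit extension [phi_ext .. phi h] by [o(h)] uniformly on
[[-Delta, 0]]: on the new part of the interval both equal the same delayed sum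
plus [D], and the two values of [D] differ by [D x_{t+h} - D x_t - h f(x_t)]
([phi_ext_consistent]).  For a Lipschitz [V], [Dplus] is therefore the upper
right Dini derivative of [V] along solutions.

Sufficiency.  Since [V <= a2 Na], condition (ii) gives
[Dplus V <= - (a3 / a2) V], so [V(x_t)] decays exponentially
([lyapunov_decay]), and so does [D x_t] by the lower bound in (i).  It remains
to pass from [D x_t] to [x], that is, to bound the solutions of
[x(t) = sum_j A_j x(t - Delta_j) + g(t)] with an exponentially small forcing
[g] ([difference_exp_stable]).  Strong stability, for the given delays, provides
attractivity of the unforced equation.  On a window of length [T], [x] is
compared with a solution [y] that has the same history but whose forcing is
switched off linearly during one unit of time: afterwards [y] is an unforced
solution, hence it is small at the end of the window, while [x - y] starts from
zero and is of the size of the forcing.  So a window halves the history up to a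
multiple of the forcing, and iterating gives the rate.

Necessity.  With decay rate [2 lam], the functional
[V(phi) = sup of e^{lam t} |x(t + tau)|] over [t >= 0] and [tau] in
[[-Delta, 0]], where [x] is the solution with history [phi], is between
multiples of the sup norm, and shifting [phi] along the flow by [h]
multiplies it by at most [e^{- lam h}], which gives (ii) with the sup norm as
the semi-norm.  The solution map is Lipschitz only with an exponentially
growing constant, but [V] is Lipschitz because the terms with [t] large are
dominated by the norm of [phi] itself ([peak_lipschitz]).

Solutions are obtained from a contraction in the weighted sup norm with weight
[e^{- mu s}] ([neutral_fixpoint]): for [mu] large both the delayed sum and the
integral of [f] become contractions, so no step-by-step construction is needed.
The same weight gives Lipschitz dependence on the history ([weighted_growth],
[forward_solution_dependence]).  Throughout, vectors are measured in the max
norm [`|v|], which satisfies [`|v| <= enorm v <= n `|v|]. *)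

Set Implicit Arguments.
Unset Strict Implicit.

(** * Continuity, Dini derivatives and the mean value inequality *)

Section Analysis.
Variables (R : realType) (V : normedModType R).
Implicit Types (u : R -> R) (x z : R -> V).

Lemma continuous_epsP x : continuous x <->
  forall t e, 0 < e -> exists2 d, 0 < d & forall s, `|s - t| < d -> `|x s - x t| < e.
Proof.
split=> [cx t e e0|H t].
  have /cvgrPdist_lt/(_ e e0)/nbhs_ballP[d /= d0 Hd] := cx t.
  exists d => // s st; rewrite distrC; apply: Hd.
  by rewrite /ball /= distrC.
apply/cvgrPdist_lt => e e0; have [d d0 Hd] := H t e e0.
apply/nbhs_ballP; exists d => //= s; rewrite /ball /= => st.
by rewrite distrC; apply: Hd; rewrite distrC.
Qed.

Lemma continuous_shift x a : continuous x -> continuous (fun t => x (a + t)).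
Proof.
move=> cx; apply/continuous_epsP => t e e0.
have [d d0 Hd] := (continuous_epsP _).1 cx (a + t) e e0; exists d => // s st.
by apply: Hd; rewrite opprD addrACA subrr add0r.
Qed.

Lemma segment_unif_continuous x a b e : continuous x -> 0 < e ->
  exists2 d, 0 < d & forall t s, a <= t <= b -> `|s - t| < d -> `|x s - x t| < e.
Proof.
move=> cx e0.
have /compact_near_coveringP cK := @segment_compact R a b.
have H : forall t, `[a, b]%classic t -> \forall t' \near t & d \near 0^'+,
    forall s, `|s - t'| < d -> `|x s - x t'| < e.
  move=> t _.
  have e20 : 0 < e / 2 by rewrite divr_gt0.
  have [d d0 Hd] := (continuous_epsP x).1 cx t _ e20.
  have d20 : 0 < d / 2 by rewrite divr_gt0.
  exists (ball t (d / 2), [set r | r < d / 2]) => /=.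
    split; first exact: nbhsx_ballx.
    exact: nbhs_right_lt.
  move=> [t' r] /= [Ht' Hr] s Hs.
  have Ht'd : `|t' - t| < d / 2 by rewrite distrC.
  have h1 : `|x t' - x t| < e / 2 by apply: Hd; lra.
  have h2 : `|x s - x t| < e / 2.
    apply: Hd; have := ler_distD t' s t; lra.
  have := ler_distD (x t) (x s) (x t'); rewrite [`|x t - x t'|]distrC; lra.
have [d /= d0 Hd] := cK R (0^'+) (fun d t => forall s, `|s - t| < d -> `|x s - x t| < e) _ H.
exists (d / 2); first by rewrite divr_gt0.
move=> t s tab st; apply: (Hd (d / 2)) => //=.
- by rewrite /ball_ /= sub0r normrN gtr0_norm ?divr_gt0// ltr_pdivrMr// ltr_pMr// ltr1n.
- by rewrite divr_gt0.
Qed.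

Lemma segment_bounded x a b : continuous x ->
  exists2 M, 0 < M & forall t, a <= t <= b -> `|x t| <= M.
Proof.
move=> cx.
have cK : compact (x @` `[a, b]%classic).
  apply: continuous_compact; last exact: segment_compact.
  exact: continuous_subspaceT.
have /ex_strict_bound_gt0[M M0 HM] := compact_bounded cK.
by exists M => // t tab; apply/ltW/HM; exists t => //=; rewrite in_itv.
Qed.

End Analysis.

Section Dini.
Variable R : realType.
Implicit Type u : R -> R.

(** The upper right Dini derivative of [u] at [t] is nonpositive; spelled out with
[e] and [d] because this is the form in which it is produced and consumed. *)
Definition dini_le0 u t :=
  forall e, 0 < e -> exists2 d, 0 < d & forall h, 0 < h -> h < d -> u (t + h) <= u t + e * h.

(** For each [e > 0], the supremum of the times up to which
[u s <= u a + e (s - a)] holds is [b]: by continuity the bound persists at that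
supremum, and the Dini condition pushes it strictly further. *)
Lemma dini_nonincreasing u a b : continuous u -> a <= b ->
  (forall t, a <= t < b -> dini_le0 u t) -> u b <= u a.
Proof.
move=> /(@continuous_epsP R R^o) cu ab Hu.
suff H e : 0 < e -> u b <= u a + e * (b - a).
  apply/ler_addgt0Pl => e e0.
  have := H (e / (b - a + 1)); rewrite divr_gt0//; last by lra.
  move=> /(_ isT) /le_trans; apply; rewrite addrC lerD2r.
  rewrite mulrAC ler_pdivrMr; last by lra.
  rewrite ler_pM2l //; lra.
move=> e0.
pose S := [set t | a <= t <= b /\ forall s, a <= s <= t -> u s <= u a + e * (s - a)].
have Sa : S a.
  split=> [|s sa]; first by rewrite lexx.
  have -> : s = a by lra.
  by rewrite subrr mulr0 addr0.
have hS : has_sup S by split; [exists a|exists b => t [/andP[]]].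
pose c := sup S.
have ac : a <= c by apply: sup_ubound => //; case: hS.
have cb : c <= b by apply: sup_le_ub; [exists a|move=> t [/andP[]]].
have Hlt s : a <= s -> s < c -> u s <= u a + e * (s - a).
  move=> as_ sc; have [t [tab Ht] st] := sup_gt (ex_intro _ a Sa) sc.
  by apply: Ht; rewrite as_ ltW.
have Hc : u c <= u a + e * (c - a).
  rewrite leNgt; apply/negP => uc.
  have ac' : a < c.
    rewrite lt_neqAle ac andbT; apply/eqP => acE; move: uc.
    by rewrite -acE subrr mulr0 addr0 ltxx.
  have [d d0 Hd] := cu c (u c - (u a + e * (c - a))) ltac:(lra).
  pose s := Num.max a (c - d / 2).
  have sc : s < c by rewrite gt_max ac' /=; lra.
  have as_ : a <= s by rewrite le_max lexx.
  have sc2 : c - d / 2 <= s by rewrite le_max lexx orbT.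
  have /Hd : `|s - c| < d by rewrite ltr_norml; apply/andP; split; lra.
  rewrite ltr_norml => /andP[h1 h2].
  have := Hlt s as_ sc; have : e * (s - a) <= e * (c - a) by rewrite ler_pM2l//; lra.
  lra.
suff <- : c = b by [].
apply/eqP; rewrite eq_le cb /= leNgt; apply/negP => ltcb.
have [|d d0 Hd] := Hu c _ e e0; first by rewrite ac.
pose h := Num.min (b - c) (d / 2).
have h0 : 0 < h by rewrite lt_min; apply/andP; split; lra.
have hb : h <= b - c by rewrite ge_min lexx.
have hd : h <= d / 2 by rewrite ge_min lexx orbT.
have : S (c + h).
  split; first by apply/andP; split; lra.
  move=> s /andP[as_ sch].
  have [sc|] := ltP s c; first exact: Hlt.
  rewrite le_eqVlt => /predU1P[<-//|cs].
  have := Hd (s - c) ltac:(lra) ltac:(lra); rewrite addrC subrK => /le_trans; apply.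
  have -> : e * (s - a) = e * (s - c) + e * (c - a) by ring.
  lra.
move=> Sch; have : c + h <= c by apply: sup_ubound => //; case: hS.
lra.
Qed.

(** This replaces the Gronwall inequality: with an exponential weight inside [u], an
a priori bound improves to [c + m / 2], and applying that to the supremum of
[u], which is finite, absorbs the second term. *)
Lemma absorption (T : Type) (D : set T) (u : T -> R) (c : R) : 0 <= c ->
  (exists M, forall s, D s -> u s <= M) ->
  (forall m, 0 <= m -> (forall s, D s -> u s <= m) -> forall s, D s -> u s <= c + m / 2) ->
  forall s, D s -> u s <= 2 * c.
Proof.
move=> c0 [M HM] H s Ds.
have hS : has_sup (u @` D).
  by split; [exists (u s); exists s|exists M => _ [t Dt <-]; exact: HM].
have ub t : D t -> u t <= sup (u @` D).
  by move=> Dt; apply: sup_ubound; [case: hS|exists t].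
pose m := Num.max 0 (sup (u @` D)).
have Hm t : D t -> u t <= m by move=> Dt; rewrite le_max ub ?orbT.
have m0 : 0 <= m by rewrite le_max lexx.
have H' := H m m0 Hm.
have : m <= c + m / 2.
  rewrite ge_max; apply/andP; split; first by rewrite addr_ge0// divr_ge0.
  by apply: sup_le_ub; [exists (u s); exists s|move=> _ [t Dt <-]; exact: H'].
have := Hm s Ds; lra.
Qed.

End Dini.

Section Mvi.
Variables (R : realType) (V : normedModType R).

(** Stated without a division, so that the error estimate is available as such. *)
Definition right_derivative (G : R -> V) (t : R) (l : V) :=
  forall e, 0 < e -> exists2 d, 0 < d &
    forall h, 0 < h -> h < d -> `|G (t + h) - G t - h *: l| <= e * h.

(** [`|G t - G a| - L / mu e^{mu t}] has nonpositive Dini derivative, because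
[e^{mu (t + h)} - e^{mu t} >= mu h e^{mu t}]. *)
Lemma exp_mean_value (G g : R -> V) (L mu : R) a b : continuous G ->
  0 < mu -> a <= b ->
  (forall t, a <= t < b -> right_derivative G t (g t)) ->
  (forall t, a <= t < b -> `|g t| <= L * expR (mu * t)) ->
  `|G b - G a| <= L / mu * (expR (mu * b) - expR (mu * a)).
Proof.
move=> cG mu0 ab dG bg.
pose u t := `|G t - G a| - L / mu * expR (mu * t).
suff : u b <= u a by rewrite /u subrr normr0; lra.
apply: dini_nonincreasing => //.
  move=> t; apply: cvgB.
    by apply: cvg_norm; apply: cvgB; [exact: cG|exact: cvg_cst].
  apply: cvgM; first exact: cvg_cst.
  apply: continuous_comp; first by apply: cvgM; [exact: cvg_cst|exact: cvg_id].
  exact: continuous_expR.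
move=> t tab e e0; have [d d0 Hd] := dG t tab e e0; exists d => // h h0 hd.
have := Hd h h0 hd => H1; have H2 := bg t tab.
have L0 : 0 <= L.
  by have := le_trans (normr_ge0 _) H2; rewrite pmulr_lge0 // expR_gt0.
rewrite /u.
have T1 : `|G (t + h) - G a| <= `|G t - G a| + e * h + h * `|g t|.
  have -> : G (t + h) - G a = (G t - G a) + (G (t + h) - G t - h *: g t) + h *: g t.
    by rewrite -addrA subrK [RHS]addrC addrA subrK.
  apply: (le_trans (ler_normD _ _)); rewrite normrZ gtr0_norm //.
  have := ler_normD (G t - G a) (G (t + h) - G t - h *: g t); lra.
have T2 : L * expR (mu * t) * h <= L / mu * (expR (mu * (t + h)) - expR (mu * t)).
  have -> : L / mu * (expR (mu * (t + h)) - expR (mu * t)) =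
     L / mu * expR (mu * t) * (expR (mu * h) - 1) by rewrite [mu * (t + h)]mulrDr expRD; ring.
  have -> : L * expR (mu * t) * h = L / mu * expR (mu * t) * (mu * h).
    by field; rewrite gt_eqF.
  apply: ler_wpM2l; first by rewrite mulr_ge0 ?expR_ge0// divr_ge0// ltW.
  have := expR_ge1Dx (mu * h); lra.
have : h * `|g t| <= L * expR (mu * t) * h by rewrite mulrC ler_pM2r.
lra.
Qed.

End Mvi.

(** * Vector norms and history functions *)

Section VectorNorm.
Variables (R : realType) (n : nat).
Implicit Type v : 'cV[R]_n.

Lemma norm_coord_le v i : `|v i ord0| <= `|v|.
Proof.
rewrite [leRHS]/Num.Def.normr /= mx_normrE; apply/bigmax_geP; right => /=.
by exists (i, ord0).
Qed.

Lemma norm_le_coord v c : 0 <= c -> (forall i, `|v i ord0| <= c) -> `|v| <= c.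
Proof.
move=> c0 H; rewrite [leLHS]/Num.Def.normr /= mx_normrE; apply/bigmax_leP; split => //= -[i j] _ /=.
by rewrite ord1.
Qed.

Lemma norm_le_enorm v : `|v| <= enorm v.
Proof.
apply: norm_le_coord => [|i]; first exact: sqrtr_ge0.
rewrite -sqrtr_sqr; apply: ler_wsqrtr; rewrite (bigD1 i) //= lerDl.
by apply: sumr_ge0 => j _; exact: sqr_ge0.
Qed.

Lemma enorm_le v : enorm v <= n%:R * `|v|.
Proof.
rewrite -(@ger0_norm _ (n%:R * _)) ?mulr_ge0// -sqrtr_sqr.
apply: ler_wsqrtr; apply: (@le_trans _ _ (\sum_(i < n) `|v| ^+ 2)).
  apply: ler_sum => i _; rewrite -real_normK ?num_real//.
  by rewrite ler_pXn2r ?nnegrE ?norm_coord_le.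
rewrite sumr_const card_ord -[X in X <= _]mulr_natl exprMn.
rewrite ler_wpM2r ?sqr_ge0//.
by rewrite -natrX ler_nat; case: (n) => // k; rewrite -[leqLHS]expn1 leq_pexp2l.
Qed.

Lemma norm_mulmx_le (M : 'M[R]_n) v : `|M *m v| <= n%:R * `|M| * `|v|.
Proof.
apply: norm_le_coord => [|i]; first by rewrite !mulr_ge0.
rewrite mxE; apply: (le_trans (ler_norm_sum _ _ _)).
rewrite -mulrA mulr_natl -[X in _ *+ X]card_ord -sumr_const.
apply: ler_sum => j _; rewrite normrM ler_pM ?norm_coord_le//.
by rewrite [leRHS]/Num.Def.normr /= mx_normrE; apply/bigmax_geP; right => /=; exists (i, j).
Qed.

End VectorNorm.

Section Within.
Variables (R : realType) (V : normedModType R).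

Lemma within_epsP (S : set R) (x : R -> V) : {within S, continuous x} <->
  forall t e, S t -> 0 < e ->
    exists2 d, 0 < d & forall s, S s -> `|s - t| < d -> `|x s - x t| < e.
Proof.
rewrite subspace_continuousP; split=> [cx t e St e0|H t St].
  have /cvgrPdist_lt/(_ e e0) := cx t St; rewrite near_withinE => /nbhs_ballP[d /= d0 Hd].
  exists d => // s Ss st; rewrite distrC; apply: Hd => //.
  by rewrite /ball /= distrC.
apply/cvgrPdist_lt => e e0; rewrite near_withinE; have [d d0 Hd] := H t e St e0.
apply/nbhs_ballP; exists d => //= s; rewrite /ball /= => st Ss.
by rewrite distrC; apply: Hd => //; rewrite distrC.
Qed.

(** Extends a function that is continuous on [S] only to one that is continuous
everywhere, by precomposing with a nonexpansive map into [S].  The maps used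
are truncations such as [clip] and [Num.max 0]. *)
Lemma continuous_retract (S : set R) (x : R -> V) (c : R -> R) :
  {within S, continuous x} -> (forall t, S (c t)) ->
  (forall s t, `|c s - c t| <= `|s - t|) -> continuous (x \o c).
Proof.
move=> /within_epsP cx Sc c1; apply/continuous_epsP => t e e0.
have [d d0 Hd] := cx (c t) e (Sc t) e0; exists d => // s st /=.
by apply: Hd => //; exact: le_lt_trans (c1 s t) st.
Qed.

End Within.

Section Hist.
Variables (R : realType) (n : nat) (r : R).
Hypothesis r0 : 0 <= r.
Implicit Types (phi psi : R -> 'cV[R]_n).

(** The nearest point of [[-r, 0]]. *)
Definition clip (s : R) : R := Num.max (- r) (Num.min s 0).

Lemma clip_itv s : - r <= clip s <= 0.
Proof. by rewrite /clip le_max lexx /= ge_max ge_min lexx orbT andbT oppr_le0. Qed.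

Lemma clip_id s : - r <= s <= 0 -> clip s = s.
Proof. by move=> /andP[s1 s2]; rewrite /clip min_l// max_r. Qed.

Lemma min_lip (a b c : R) : `|Num.min a c - Num.min b c| <= `|a - b|.
Proof. by case: (leP a c); case: (leP b c) => *; rewrite ler_norml; case: ler0P => *; lra. Qed.

Lemma max_lip (a b c : R) : `|Num.max c a - Num.max c b| <= `|a - b|.
Proof. by case: (leP c a); case: (leP c b) => *; rewrite ler_norml; case: ler0P => *; lra. Qed.

Lemma clip_continuous phi : hist r phi -> continuous (phi \o clip).
Proof.
move=> hphi; apply: continuous_retract hphi _ _ => [t|s t].
  by rewrite /= in_itv; exact: clip_itv.
exact: le_trans (max_lip _ _ _) (min_lip _ _ _).
Qed.

Lemma hist_bounded phi : hist r phi ->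
  exists2 M, 0 < M & forall t, - r <= t <= 0 -> `|phi t| <= M.
Proof.
move=> /clip_continuous/(segment_bounded (- r) 0)[M M0 HM]; exists M => // t tr.
by have := HM t tr; rewrite /= clip_id.
Qed.

Lemma hist_eq phi psi : (forall t, - r <= t <= 0 -> phi t = psi t) ->
  hist r phi -> hist r psi.
Proof.
move=> E; apply: subspace_eq_continuous => t.
by rewrite inE /= in_itv; exact: E.
Qed.

Lemma continuous_hist phi : continuous phi -> hist r phi.
Proof. exact: continuous_subspaceT. Qed.

Lemma hist_sub phi psi : hist r phi -> hist r psi -> hist r (phi - psi).
Proof.
move=> /clip_continuous c1 /clip_continuous c2.
apply: (@hist_eq ((phi \o clip) - (psi \o clip))) => [t tr|].
  by rewrite !fctE /= clip_id.
by apply: continuous_hist => t; apply: cvgB; [exact: c1|exact: c2].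
Qed.

Lemma hnorm_le phi c : (forall t, - r <= t <= 0 -> enorm (phi t) <= c) -> hnorm r phi <= c.
Proof.
move=> H; apply: sup_le_ub.
  by exists (enorm (phi 0)); exists 0 => //=; rewrite in_itv /= lexx oppr_le0 r0.
by move=> _ [t /= tr <-]; apply: H; rewrite in_itv in tr.
Qed.

Lemma hnorm_le_max phi c : (forall t, - r <= t <= 0 -> `|phi t| <= c) ->
  hnorm r phi <= n%:R * c.
Proof.
move=> H; apply: hnorm_le => t /H tc; apply: (le_trans (enorm_le _)).
by rewrite ler_wpM2l.
Qed.

Lemma hnorm_ge phi t : hist r phi -> - r <= t <= 0 -> enorm (phi t) <= hnorm r phi.
Proof.
move=> /hist_bounded[M M0 HM] tr; apply: sup_ubound; last first.
  by exists t => //=; rewrite in_itv.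
exists (n%:R * M) => _ [s /= sr <-]; apply: (le_trans (enorm_le _)).
by rewrite ler_wpM2l// HM//; rewrite in_itv in sr.
Qed.

Lemma hnorm_ge0 phi : hist r phi -> 0 <= hnorm r phi.
Proof.
move=> /hnorm_ge => /(_ 0) H; apply: le_trans (H _); first exact: sqrtr_ge0.
by rewrite lexx oppr_le0 r0.
Qed.

Lemma norm_le_hnorm phi t : hist r phi -> - r <= t <= 0 -> `|phi t| <= hnorm r phi.
Proof. by move=> h tr; exact: le_trans (norm_le_enorm _) (hnorm_ge h tr). Qed.

(** Only upper bounds of the sup norm of a difference are ever available, so the
Lipschitz condition is used in this form, which moreover shows at once that [Q]
sees the restrictions to [[-r, 0]] only. *)
Lemma lipschitz_max (W : zmodType) (nrm : W -> R) (Q : (R -> 'cV[R]_n) -> W) :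
  globally_lipschitz r nrm Q ->
  exists2 L, 0 <= L & forall phi psi c, hist r phi -> hist r psi ->
    (forall t, - r <= t <= 0 -> `|phi t - psi t| <= c) -> nrm (Q phi - Q psi) <= L * c.
Proof.
move=> [L L0 HL]; exists (L * n%:R) => [|phi psi c h1 h2 H]; first by rewrite mulr_ge0// ltW.
apply: (le_trans (HL _ _ h1 h2)); rewrite -mulrA ler_wpM2l//; first exact: ltW.
exact: hnorm_le_max.
Qed.

End Hist.

(** * Fixed points of weighted contractions *)

HB.instance Definition _ (R : realType) (m n : nat) := Complete.on 'M[R]_(m, n).

Section WeightedFixpoint.
Variable R : realType.

Lemma half_pow_small (C e : R) : 0 <= C -> 0 < e -> exists k, C * 2^-1 ^+ k < e.
Proof.
move=> C0 e0.
have /cvgrPdist_lt/(_ (e / (C + 1))) : (2^-1 : R) ^+ k @[k --> \oo] --> 0.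
  by apply: cvg_expr; rewrite ger0_norm; lra.
rewrite divr_gt0//; last by lra.
move=> /(_ isT) [k _ /(_ k (leqnn k))] /=; rewrite sub0r normrN ger0_norm ?exprn_ge0//.
rewrite ltr_pdivlMr; last by lra.
move=> H; exists k; apply: le_lt_trans H; rewrite mulrC ler_wpM2l ?exprn_ge0//; lra.
Qed.

Lemma geometric_cauchy (V : completeNormedModType R) (u : nat -> V) (C : R) :
  0 <= C -> (forall k, `|u k.+1 - u k| <= C * 2^-1 ^+ k) ->
  exists l, forall k, `|l - u k| <= 2 * C * 2^-1 ^+ k.
Proof.
move=> C0 Hu.
have Hm k m : `|u (k + m)%N - u k| <= 2 * C * 2^-1 ^+ k.
  suff : `|u (k + m)%N - u k| <= 2 * C * (2^-1 ^+ k - 2^-1 ^+ (k + m)).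
    move=> /le_trans; apply; rewrite ler_wpM2l ?mulr_ge0// gerBl exprn_ge0//.
  elim: m => [|m IH]; first by rewrite addn0 !subrr normr0 mulr0.
  rewrite addnS; have := Hu (k + m)%N; rewrite [in X in _ -> X]exprS => H.
  have := ler_distD (u (k + m)%N) (u (k + m).+1) (u k); lra.
have /cauchy_cvg cu : cauchy (u @ \oo).
  apply: cauchy_exP => e e0.
  have [k Hk] := half_pow_small (mulr_ge0 (ler0n R 2) C0) e0.
  exists (u k); exists k => //= m /= km; rewrite -ball_normE /= distrC.
  by have := Hm k (m - k)%N; rewrite subnKC// => H; exact: le_lt_trans H Hk.
exists (lim (u @ \oo)) => k; apply/ler_addgt0Pl => e e0.
have /cvgrPdist_lt/(_ e e0)[N _ HN] := cu.
have := HN (k + N)%N (leq_addl _ _) => /= H.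
have := ler_distD (u (k + N)%N) (lim (u @ \oo)) (u k); have := Hm k N; lra.
Qed.

(** Picard iteration for the norm [sup_s e^{- mu s} `|z s|], with [F] a contraction
of ratio 1/2.  The iterates converge pointwise with error
[2 c0 2^{-k} e^{mu s}], hence uniformly on bounded-above sets, which keeps the
limit continuous; this norm need not be finite on the whole function space. *)
Lemma weighted_fixpoint (V : completeNormedModType R) (mu c0 : R)
    (F : (R -> V) -> R -> V) (z0 : R -> V) : 0 <= mu -> 0 <= c0 ->
  continuous z0 -> (forall z, continuous z -> continuous (F z)) ->
  (forall s, `|F z0 s - z0 s| <= c0 * expR (mu * s)) ->
  (forall z w c, continuous z -> continuous w -> 0 <= c ->
     (forall s, `|z s - w s| <= c * expR (mu * s)) ->
     forall s, `|F z s - F w s| <= c / 2 * expR (mu * s)) ->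
  exists2 x, continuous x & forall s, F x s = x s.
Proof.
move=> mu0 c00 cz0 cF Hz0 HF.
pose z k := iter k F z0.
have cz k : continuous (z k) by elim: k => //= k IH; exact: cF.
have Hz k s : `|z k.+1 s - z k s| <= c0 * 2^-1 ^+ k * expR (mu * s).
  elim: k s => [|k IH] s; first by rewrite expr0 mulr1; exact: Hz0.
  have := HF _ _ _ (cz k.+1) (cz k) _ IH s; rewrite exprSr mulrA; apply.
  by rewrite mulr_ge0// exprn_ge0.
have /choice[x Hx] : forall s, exists l, forall k, `|l - z k s| <= 2 * (c0 * expR (mu * s)) * 2^-1 ^+ k.
  move=> s; apply: geometric_cauchy => [|k]; first by rewrite mulr_ge0 ?expR_ge0.
  by have := Hz k s; rewrite mulrAC.
have Hx' k s : `|x s - z k s| <= 2 * c0 * 2^-1 ^+ k * expR (mu * s).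
  by apply: (le_trans (Hx s k)); rewrite le_eqVlt; apply/orP; left; apply/eqP; ring.
have cx : continuous x.
  apply/continuous_epsP => t e e0.
  have [k Hk] := @half_pow_small (2 * c0 * expR (mu * (t + 1))) (e / 3)
     ltac:(by rewrite !mulr_ge0 ?expR_ge0) ltac:(lra).
  have [d d0 Hd] := (continuous_epsP _).1 (cz k) t (e / 3) ltac:(lra).
  have Hs s : s <= t + 1 -> `|x s - z k s| < e / 3.
    move=> st; apply: le_lt_trans Hk; apply: (le_trans (Hx' k s)).
    rewrite mulrAC; apply: ler_wpM2r; first by rewrite exprn_ge0.
    apply: ler_wpM2l; first by rewrite mulr_ge0.
    by rewrite ler_expR ler_wpM2l.
  exists (Num.min d 1); first by rewrite lt_min d0 ltr01.
  move=> s; rewrite lt_min => /andP[/Hd H1]; rewrite ltr_norml => /andP[_ H2].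
  have H3 := Hs s ltac:(lra); have := Hs t ltac:(lra).
  have := ler_distD (z k s) (x s) (x t); have := ler_distD (z k t) (z k s) (x t).
  rewrite [`|z k t - x t|]distrC; lra.
exists x => // s; apply/eqP; rewrite -subr_eq0 -normr_le0; apply/ler_addgt0Pl => e e0.
have [k Hk] := @half_pow_small (2 * c0 * expR (mu * s)) e
  ltac:(by rewrite !mulr_ge0 ?expR_ge0) e0.
have C0 : 0 <= 2 * c0 * 2^-1 ^+ k by rewrite !mulr_ge0 ?exprn_ge0.
have := HF _ _ _ cx (cz k) C0 (Hx' k) s.
have := Hx' k.+1 s; rewrite /= exprSr.
have := ler_distD (F (z k) s) (F x s) (x s).
rewrite [`|F (z k) s - x s|]distrC -/(z k); lra.
Qed.

End WeightedFixpoint.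

(** * Primitives of continuous vector functions *)

Lemma finite_pos_min (R : realType) (p : nat) (d_ : 'I_p -> R) :
  (forall j, 0 < d_ j) -> exists2 d, 0 < d & forall j, d <= d_ j.
Proof.
move=> H; exists (\big[Num.min/1]_j d_ j); last by move=> j; exact: bigmin_le.
by apply/bigmin_gtP; split => // j _; exact: H.
Qed.

Section Primitive.
Variable R : realType.

(** The derivative at [t] is relative to the half line, two-sided for [t > 0]: this
is the notion of derivative under which [neutral_solution] is defined. *)
Definition primitive_on_nneg (V : normedModType R) (q P : R -> V) : Prop :=
  P 0 = 0 /\ forall t, 0 <= t -> forall e, 0 < e -> exists2 d, 0 < d &
     forall s, 0 <= s -> `|s - t| < d -> `|P s - P t - (s - t) *: q t| <= e * `|s - t|.

(** The integral starts at -1, so that 0 is an interior point for the fundamental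
theorem of calculus. *)
Lemma real_primitive (q : R -> R) : continuous q ->
  exists P : R -> R, @primitive_on_nneg R^o q P.
Proof.
move=> cq.
pose P0 t := (\int[lebesgue_measure]_(s in `[(-1)%R, t]) q s)%R.
exists (fun t => P0 t - P0 0); split=> [|t t0 e e0]; first by rewrite subrr.
have iq : lebesgue_measure.-integrable `[-1, t + 1] (EFin \o q).
  apply: continuous_compact_integrable; first exact: segment_compact.
  exact: continuous_subspaceT.
have [dP HP] := @continuous_FTC1_closed R q (-1) t (t + 1) ltac:(lra) iq ltac:(lra) (cq t).

have /cvgrPdist_le/(_ e e0) : h^-1 *: (P0 (h + t) - P0 t) @[h --> 0^'] --> q t.
  rewrite -HP derive1E; have := dP; rewrite /derivable /derive.
  by under eq_fun do rewrite /= -[_%:A]/(_ * 1) mulr1.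
rewrite near_withinE => /nbhs_ballP[d /= d0 Hd].
exists d => // s s0 st; have [->|sneq] := eqVneq s t.
  by rewrite !subrr scale0r subrr normr0 mulr0.
have st0 : s - t != 0 by rewrite subr_eq0.
have := Hd (s - t); rewrite /ball /= sub0r normrN => /(_ st st0).
rewrite subrK distrC => H.
have -> : P0 s - P0 0 - (P0 t - P0 0) - (s - t) *: q t =
   (s - t) *: ((s - t)^-1 *: (P0 s - P0 t) - q t).
  by rewrite scalerBr scalerA divff// scale1r /GRing.scale /=; ring.
by rewrite normrZ mulrC ler_pM2r// normr_gt0.
Qed.

Lemma vector_primitive (n : nat) (q : R -> 'cV[R]_n) : continuous q ->
  exists P, primitive_on_nneg q P.
Proof.
move=> cq.
have /choice[P HP] i : exists P : R -> R, @primitive_on_nneg R^o (fun t => q t i ord0) P.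
  apply: real_primitive; apply/(@continuous_epsP R R^o) => t e e0.
  have [d d0 Hd] := (continuous_epsP _).1 cq t e e0; exists d => // s /Hd.
  apply: le_lt_trans; have := norm_coord_le (q s - q t) i; by rewrite !mxE.
exists (fun t => \col_i P i t); split=> [|t t0 e e0].
  by apply/colP => i; rewrite !mxE (HP i).1.
have /choice[d_ Hd_] i : exists d, 0 < d /\ forall s, 0 <= s -> `|s - t| < d ->
    `|P i s - P i t - (s - t) * q t i ord0| <= e * `|s - t|.
  by have [d d0 Hd] := (HP i).2 t t0 e e0; exists d.
have [d d0 Hd] := finite_pos_min (fun i => (Hd_ i).1).
exists d => // s s0 st; apply: norm_le_coord => [|i]; first by rewrite mulr_ge0// ltW.
by rewrite !mxE; apply: (Hd_ i).2 => //; exact: lt_le_trans st (Hd i).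
Qed.

Lemma primitive_continuous (V : normedModType R) (q P : R -> V) :
  primitive_on_nneg q P -> continuous (fun s : R => P (Num.max 0 s)).
Proof.
move=> [P0 HP].
apply: (@continuous_retract _ _ [set t | 0 <= t] P (Num.max 0)) => /=.
- apply/within_epsP => t e /= t0 e0.
  have [d d0 Hd] := HP t t0 1 ltr01.
  have c0 : 0 < 1 + `|q t| by rewrite ltr_pwDl.
  exists (Num.min d (e / (1 + `|q t|))); first by rewrite lt_min d0 divr_gt0.
  move=> s s0; rewrite lt_min => /andP[/(Hd s s0) H]; rewrite ltr_pdivlMr// => st.
  have := ler_normD (P s - P t - (s - t) *: q t) ((s - t) *: q t).
  rewrite subrK normrZ; lra.
- by move=> t; rewrite le_max lexx.
- by move=> s t; exact: max_lip.
Qed.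

Lemma primitive_right_derivative (V : normedModType R) (q P : R -> V) t :
  primitive_on_nneg q P -> 0 <= t -> right_derivative (fun s => P (Num.max 0 s)) t (q t).
Proof.
move=> [_ HP] t0 e e0; have [d d0 Hd] := HP t t0 e e0; exists d => // h h0 hd.
have th : 0 <= t + h by lra.
have := Hd (t + h) th; rewrite !max_r// [t + h - t]addrAC subrr add0r gtr0_norm//.
exact.
Qed.

End Primitive.

(** * Delayed sums and exponential weights *)

Section DelaySum.
Variables (R : realType) (n p : nat) (A : 'I_p -> 'M[R]_n) (delay : 'I_p -> R).
Implicit Types (x y z : R -> 'cV[R]_n).

Definition delay_sum x t : 'cV[R]_n := \sum_(j < p) A j *m x (t - delay j).

Lemma Dop_seg x t : Dop A delay (seg x t) = x t - delay_sum x t.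
Proof. by rewrite /Dop /seg addr0. Qed.

Lemma Dop0 x : Dop A delay x = x 0 - delay_sum x 0.
Proof. by rewrite -Dop_seg; congr Dop; apply/funext => s; rewrite /seg add0r. Qed.

Lemma delay_sumB x y t : delay_sum (fun s => x s - y s) t = delay_sum x t - delay_sum y t.
Proof. by rewrite /delay_sum -sumrB; apply: eq_bigr => j _; rewrite mulmxBr. Qed.

Lemma delay_sum_shift x a t : delay_sum (fun s => x (a + s)) t = delay_sum x (a + t).
Proof. by apply: eq_bigr => j _; rewrite addrA. Qed.

Lemma delay_sumZ x (a : R) t : delay_sum (fun s => a *: x s) t = a *: delay_sum x t.
Proof. by rewrite /delay_sum scaler_sumr; apply: eq_bigr => j _; rewrite scalemxAr. Qed.

Lemma eq_delay_sum x y t : (forall j, x (t - delay j) = y (t - delay j)) ->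
  delay_sum x t = delay_sum y t.
Proof. by move=> H; apply: eq_bigr => j _; rewrite H. Qed.

(** An upper bound for the norm of [x |-> delay_sum x t]; the factor [n] is that of
[norm_mulmx_le]. *)
Definition delay_gain : R := \sum_(j < p) n%:R * `|A j|.

Lemma delay_gain_ge0 : 0 <= delay_gain.
Proof. by apply: sumr_ge0 => j _; rewrite mulr_ge0. Qed.

Lemma norm_delay_sum_le x t c : (forall j, `|x (t - delay j)| <= c) ->
  `|delay_sum x t| <= delay_gain * c.
Proof.
move=> H; apply: (le_trans (ler_norm_sum _ _ _)); rewrite mulr_suml.
apply: ler_sum => j _; apply: (le_trans (norm_mulmx_le _ _)).
by rewrite ler_wpM2l// mulr_ge0.
Qed.

Lemma delay_sum_continuous x : continuous x -> continuous (delay_sum x).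
Proof.
move=> cx; apply/continuous_epsP => t e e0.
have K0 := delay_gain_ge0.
have e10 : 0 < e / (delay_gain + 1) by rewrite divr_gt0//; lra.
have /choice[d_ Hd_] j : exists d, 0 < d /\
    forall s, `|s - (t - delay j)| < d -> `|x s - x (t - delay j)| < e / (delay_gain + 1).
  by have [d d0 Hd] := (continuous_epsP _).1 cx (t - delay j) _ e10; exists d.
have [d d0 Hd] := finite_pos_min (fun j => (Hd_ j).1).
exists d => // s st.
have -> : delay_sum x s = delay_sum (fun r => x (s - t + r)) t.
  by rewrite delay_sum_shift subrK.
rewrite -delay_sumB.
apply: (@le_lt_trans _ _ (delay_gain * (e / (delay_gain + 1)))).
  apply: norm_delay_sum_le => j; apply/ltW/(Hd_ j).2.
  by rewrite addrK; exact: lt_le_trans st (Hd j).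
rewrite mulrCA gtr_pMr// ltr_pdivrMr; lra.
Qed.

(** In the norm weighted by [e^{- mu s}] a delay of at least [d] costs a factor
[e^{- mu d}] and integration of an [Lf]-Lipschitz map a factor [Lf / mu].  The
value 1/8 keeps the sum of the three such terms of a Picard step, two delayed
sums and an integral, below 1/2. *)
Definition heavy_weight (Lf mu : R) : Prop :=
  [/\ 0 < mu, Lf / mu <= 8^-1 & forall z t c, 0 <= c ->
     (forall j, `|z (t - delay j)| <= c * expR (mu * (t - delay j))) ->
     `|delay_sum z t| <= c / 8 * expR (mu * t)].

Lemma heavy_weight_exists Lf : (forall j, 0 < delay j) -> 0 <= Lf ->
  exists mu, heavy_weight Lf mu.
Proof.
move=> /finite_pos_min[d d0 Hd] L0; have K0 := delay_gain_ge0.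
have K8 : 0 <= 8 * delay_gain / d by rewrite divr_ge0 ?mulr_ge0 ?(ltW d0).
pose mu := 8 * delay_gain / d + 8 * Lf + 1.
have mu0 : 0 < mu by rewrite /mu; lra.
exists mu; split=> //.
  rewrite ler_pdivrMr// /mu; lra.
move=> z t c c0 H.
have Kd : delay_gain * expR (- (mu * d)) <= 8^-1.
  rewrite expRN ler_pdivrMr ?expR_gt0//.
  apply: (@le_trans _ _ (8^-1 * (1 + mu * d))); last by rewrite ler_wpM2l ?expR_ge1Dx.
  have -> : mu * d = 8 * delay_gain + (8 * Lf + 1) * d.
    by rewrite /mu -addrA mulrDl mulfVK// gt_eqF.
  have : 0 <= (8 * Lf + 1) * d by rewrite mulr_ge0 ?ltW//; lra.
  lra.
apply: (@le_trans _ _ (delay_gain * (c * (expR (mu * t) * expR (- (mu * d)))))).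
  apply: norm_delay_sum_le => j; apply: (le_trans (H j)).
  by rewrite ler_wpM2l// -expRD ler_expR mulrBr lerD2l lerN2 ler_pM2l.
have -> : delay_gain * (c * (expR (mu * t) * expR (- (mu * d)))) =
  delay_gain * expR (- (mu * d)) * (c * expR (mu * t)) by ring.
have : delay_gain * expR (- (mu * d)) * (c * expR (mu * t)) <= 8^-1 * (c * expR (mu * t)).
  by rewrite ler_wpM2r// mulr_ge0// expR_ge0.
lra.
Qed.

(** [absorption] applied to [`|z s| e^{- mu s}]: on the history this quantity is at
most [c e^{mu Delta}], and later the weight makes the delayed sum contribute
[m / 8] and the remaining term [c' + m / 4]. *)
Lemma weighted_growth (Delta Lf mu : R) z c c' T :
  (forall j, 0 < delay j <= Delta) -> heavy_weight Lf mu -> 0 <= Delta ->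
  continuous z -> 0 <= c -> 0 <= c' ->
  (forall t, - Delta <= t <= 0 -> `|z t| <= c) ->
  (forall m, 0 <= m -> (forall s, - Delta <= s <= T -> `|z s| <= m * expR (mu * s)) ->
     forall t, 0 <= t <= T -> `|z t - delay_sum z t| <= (c' + m / 4) * expR (mu * t)) ->
  forall t, - Delta <= t <= T ->
    `|z t| <= 2 * (c * expR (mu * Delta) + c') * expR (mu * t).
Proof.
move=> dD [mu0 _ Hw] D0 cz c0 c'0 Hc Hz t tT.
rewrite -ler_pdivrMr ?expR_gt0//.
apply: (@absorption R R [set s | - Delta <= s <= T] (fun s => `|z s| / expR (mu * s))) => //.
- by rewrite addr_ge0// mulr_ge0 ?expR_ge0.
- have [M M0 HM] := segment_bounded (- Delta) T cz.
  exists (M * expR (mu * Delta)) => s /= sT.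
  rewrite -expRN; apply: ler_pM => //; rewrite ?expR_ge0 ?HM//.
  by rewrite ler_expR -mulrN ler_pM2l//; lra.
move=> m m0 Hm s /= sT; rewrite ler_pdivrMr ?expR_gt0//.
have {}Hm r : - Delta <= r <= T -> `|z r| <= m * expR (mu * r).
  by move=> /Hm; rewrite ler_pdivrMr ?expR_gt0.
have [s0|s0] := leP s 0.
  have E : c <= c * expR (mu * Delta) * expR (mu * s).
    rewrite -mulrA -expRD -mulrDr ler_peMr// -expR0 ler_expR mulr_ge0 ?(ltW mu0)//.
    lra.
  apply: (le_trans (Hc s _)); first by lra.
  apply: (le_trans E); rewrite ler_wpM2r ?expR_ge0//; lra.
have H1 := Hz m m0 Hm s ltac:(lra).
have H2 : `|delay_sum z s| <= m / 8 * expR (mu * s).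
  apply: Hw => // j; apply: Hm; have := dD j; lra.
have := ler_normD (z s - delay_sum z s) (delay_sum z s); rewrite subrK => H3.
have E0 := expR_gt0 (mu * s).
have H4 : 0 <= c * expR (mu * Delta) * expR (mu * s) by rewrite !mulr_ge0 ?expR_ge0.
have H5 : 0 <= m * expR (mu * s) by rewrite mulr_ge0 ?expR_ge0.
lra.
Qed.

End DelaySum.

(** * A fixed point theorem for neutral equations *)

Section Neutral.
Variables (R : realType) (n p : nat) (Delta : R) (delay : 'I_p -> R) (A : 'I_p -> 'M[R]_n).
Hypothesis Delta_gt0 : 0 < Delta.
Hypothesis delay_bounds : forall j, 0 < delay j <= Delta.
Implicit Types (x y z w : R -> 'cV[R]_n) (phi psi : R -> 'cV[R]_n).

Let S := delay_sum A delay.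

Lemma zero_in_hist : - Delta <= (0 : R) <= 0.
Proof. by rewrite oppr_le0 (ltW Delta_gt0) lexx. Qed.

Lemma delay_in_hist j : - Delta <= 0 - delay j <= 0.
Proof. by have /andP[d0 dD] := delay_bounds j; rewrite sub0r lerN2 dD oppr_le0 ltW. Qed.

Lemma eq_Dop phi psi : (forall t, - Delta <= t <= 0 -> phi t = psi t) ->
  Dop A delay phi = Dop A delay psi.
Proof.
move=> E; rewrite !Dop0 E ?zero_in_hist//; congr (_ - _).
by apply: eq_delay_sum => j; apply: E; exact: delay_in_hist.
Qed.

Lemma norm_Dop_le phi c : (forall t, - Delta <= t <= 0 -> `|phi t| <= c) ->
  `|Dop A delay phi| <= (1 + delay_gain A) * c.
Proof.
move=> H; rewrite Dop0; apply: (le_trans (ler_normB _ _)); rewrite mulrDl mul1r.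
apply: lerD; first exact/H/zero_in_hist.
by apply: norm_delay_sum_le => j; apply: H; exact: delay_in_hist.
Qed.

(** The equation [D x_t = D phi + G x t] covers the neutral equation ([G] the
integral of [f] along [x]) and the forced difference equation ([G] an explicit
function). *)
Lemma neutral_fixpoint (Lf mu c0 : R) (G : (R -> 'cV[R]_n) -> R -> 'cV[R]_n) phi :
  heavy_weight A delay Lf mu -> hist Delta phi -> 0 <= c0 ->
  (forall z, continuous z -> G z 0 = 0) ->
  (forall z, continuous z -> continuous (fun s : R => G z (Num.max 0 s))) ->
  (forall z w c, continuous z -> continuous w -> 0 <= c ->
     (forall s, `|z s - w s| <= c * expR (mu * s)) ->
     forall m, 0 <= m -> `|G z m - G w m| <= c / 8 * expR (mu * m)) ->
  (forall m, 0 <= m -> `|G (phi \o clip Delta) m| <= c0 * expR (mu * m)) ->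
  exists x, [/\ continuous x, forall s, - Delta <= s <= 0 -> x s = phi s &
    forall t, 0 <= t -> Dop A delay (seg x t) = Dop A delay phi + G x t].
Proof.
move=> [mu0 _ Hw] hphi c00 G0 cG GL Gz; have D0 := ltW Delta_gt0.
pose z0 := phi \o clip Delta; have cz0 : continuous z0 by exact: clip_continuous.
have [M M0 HM] := hist_bounded D0 hphi.
have K0 := @delay_gain_ge0 _ _ _ A.
(* For [s <= 0] this is the prescribed history, frozen at [phi (- Delta)] before
   [- Delta]; for [s >= 0] it is the equation solved for [x s].  A single formula
   for both keeps [F z] continuous for every [z]. *)
pose F z s := z0 s + (S z (Num.max 0 s) - S z 0) + G z (Num.max 0 s).
have Fneg z s : continuous z -> s <= 0 -> F z s = z0 s.
  by move=> cz s0; rewrite /F max_l// subrr G0// !addr0.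
have exp1 s : 0 <= s -> 1 <= expR (mu * s).
  by move=> s0; rewrite -expR0 ler_expR mulr_ge0// ltW.
have [x cx Hx] : exists2 x, continuous x & forall s, F x s = x s.
  apply: (@weighted_fixpoint R 'cV[R]_n mu (2 * (delay_gain A * M) + c0) F z0) => //.
  - exact: ltW.
  - by rewrite addr_ge0// !mulr_ge0// ltW.
  - move=> z cz s; apply: cvgD; last exact: cG.
    apply: cvgD; first exact: cz0.
    apply: cvgB; last exact: cvg_cst.
    apply: (@continuous_retract R _ setT (S z) (Num.max 0)) => //.
      exact/continuous_subspaceT/delay_sum_continuous.
    by move=> r t; exact: max_lip.
  - move=> s; have [s0|s0] := leP s 0.
      rewrite Fneg// subrr normr0 mulr_ge0 ?expR_ge0// addr_ge0// !mulr_ge0//.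
      exact: ltW.
    have SM t : `|S z0 t| <= delay_gain A * M.
      by apply: norm_delay_sum_le => j; apply: HM; exact: clip_itv.
    rewrite /F max_r ?(ltW s0)// addrAC [z0 s + _]addrC addrK.
    have H1 := Gz s (ltW s0); have H2 := SM s; have H3 := SM 0.
    have := ler_normD (S z0 s - S z0 0) (G z0 s).
    have := ler_normB (S z0 s) (S z0 0).
    have H4 : 2 * (delay_gain A * M) <= 2 * (delay_gain A * M) * expR (mu * s).
      by rewrite ler_peMr ?exp1 ?(ltW s0)// !mulr_ge0// ltW.
    rewrite /z0 in H1 H2 H3 *; lra.
  - move=> z w c cz cw c_ge0 Hzw s; have [s0|s0] := leP s 0.
      by rewrite !Fneg// subrr normr0 !mulr_ge0 ?expR_ge0.
    have H t : `|S z t - S w t| <= c / 8 * expR (mu * t).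
      by rewrite /S -delay_sumB; apply: Hw => // j; exact: Hzw.
    rewrite /F max_r ?(ltW s0)//.
    have -> : z0 s + (S z s - S z 0) + G z s - (z0 s + (S w s - S w 0) + G w s)
       = ((S z s - S w s) - (S z 0 - S w 0)) + (G z s - G w s).
      by apply/colP => i; rewrite !mxE; ring.
    have H1 := H s; have := H 0; rewrite mulr0 expR0 => H2.
    have H3 := GL z w c cz cw c_ge0 Hzw s (ltW s0).
    have := ler_normD ((S z s - S w s) - (S z 0 - S w 0)) (G z s - G w s).
    have := ler_normB (S z s - S w s) (S z 0 - S w 0).
    have : c <= c * expR (mu * s) by rewrite ler_peMr ?exp1 ?(ltW s0).
    lra.
have x_hist s : - Delta <= s <= 0 -> x s = phi s.
  by move=> sD; rewrite -Hx Fneg//; [rewrite /z0 /= clip_id|lra].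
exists x; split => // t t0; rewrite Dop_seg -[in LHS]Hx /F max_r//.
have -> : z0 t = phi 0.
  by rewrite /z0 /= /clip min_r// max_r// oppr_le0.
rewrite Dop0 -/S.
have -> : S x 0 = S phi 0.
  by apply: eq_delay_sum => j; apply: x_hist; exact: delay_in_hist.
by apply/colP => i; rewrite !mxE; ring.
Qed.

End Neutral.

(** * Solutions of the neutral equation *)

Section Solutions.
Variables (R : realType) (n p : nat) (Delta : R) (delay : 'I_p -> R) (A : 'I_p -> 'M[R]_n).
Hypothesis Delta_gt0 : 0 < Delta.
Hypothesis delay_bounds : forall j, 0 < delay j <= Delta.
Implicit Types (x y z w : R -> 'cV[R]_n) (phi psi : R -> 'cV[R]_n).

(** The form of the Lipschitz condition given by [lipschitz_max], for maps into a
normed space. *)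
Definition sup_lipschitz (W : normedModType R) (Q : (R -> 'cV[R]_n) -> W) (L : R) :=
  0 <= L /\ forall phi psi c, hist Delta phi -> hist Delta psi ->
    (forall t, - Delta <= t <= 0 -> `|phi t - psi t| <= c) -> `|Q phi - Q psi| <= L * c.

Lemma eq_sup_lipschitz (W : normedModType R) (Q : (R -> _) -> W) L phi psi : sup_lipschitz Q L -> hist Delta phi ->
  (forall t, - Delta <= t <= 0 -> phi t = psi t) -> Q phi = Q psi.
Proof.
move=> [L0 HL] h1 E; apply/eqP; rewrite -subr_eq0 -normr_le0.
rewrite -[leRHS](mulr0 L); apply: HL => //; first exact: hist_eq E h1.
by move=> t /E ->; rewrite subrr normr0.
Qed.

Lemma seg_hist x t : continuous x -> hist Delta (seg x t).
Proof. by move=> cx; apply: continuous_hist; exact: continuous_shift. Qed.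

Lemma seg_unif_continuous x t e : continuous x -> 0 < e -> exists2 d, 0 < d &
  forall s, `|s - t| < d -> forall tau, - Delta <= tau <= 0 ->
    `|seg x s tau - seg x t tau| <= e.
Proof.
move=> cx e0; have [d d0 Hd] := segment_unif_continuous (t - Delta) t cx e0.
exists d => // s st tau tauD; apply/ltW/Hd; first by lra.
by rewrite opprD addrACA subrr addr0.
Qed.

Lemma functional_seg_continuous (W : normedModType R) (Q : (R -> _) -> W) L x : sup_lipschitz Q L ->
  continuous x -> continuous (fun t => Q (seg x t)).
Proof.
move=> [L0 HL] cx; apply/continuous_epsP => t e e0.
have L10 : 0 < L + 1 by lra.
have [d d0 Hd] := seg_unif_continuous t cx (divr_gt0 e0 L10).
exists d => // s /Hd H; apply: (@le_lt_trans _ _ (L * (e / (L + 1)))).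
  by apply: HL => //; exact: seg_hist.
rewrite mulrCA gtr_pMr// ltr_pdivrMr//; lra.
Qed.

Lemma right_derivativeB (G H : R -> 'cV[R]_n) t l k : right_derivative G t l -> right_derivative H t k ->
  right_derivative (fun s => G s - H s) t (l - k).
Proof.
move=> dG dH e e0; have e20 : 0 < e / 2 by lra.
have [d1 d10 H1] := dG _ e20; have [d2 d20 H2] := dH _ e20.
exists (Num.min d1 d2); first by rewrite lt_min d10.
move=> h h0; rewrite lt_min => /andP[/(H1 h h0) {}H1 /(H2 h h0) {}H2].
have -> : G (t + h) - H (t + h) - (G t - H t) - h *: (l - k) =
  (G (t + h) - G t - h *: l) - (H (t + h) - H t - h *: k).
  by apply/colP => i; rewrite !mxE; ring.
apply: (le_trans (ler_normB _ _)); lra.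
Qed.

(** The mean value inequality for [G - H], whose right derivative
[f(z_t) - f(w_t)] is at most [L c e^{mu t}] as the weight increases with time. *)
Lemma integral_difference_bound f L mu (G H : R -> 'cV[R]_n) z w T c :
  sup_lipschitz f L -> 0 < mu -> 0 <= c -> continuous z -> continuous w ->
  continuous G -> continuous H ->
  (forall t, 0 <= t -> right_derivative G t (f (seg z t))) ->
  (forall t, 0 <= t -> right_derivative H t (f (seg w t))) ->
  (forall s, - Delta <= s <= T -> `|z s - w s| <= c * expR (mu * s)) ->
  forall t, 0 <= t <= T ->
    `|G t - H t - (G 0 - H 0)| <= L / mu * c * expR (mu * t).
Proof.
move=> [L0 HL] mu0 c0 cz cw cG cH dG dH Hzw t /andP[t0 tT].
have cGH : continuous (fun s => G s - H s) by move=> s; apply: cvgB; [exact: cG|exact: cH].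
have dGH s : 0 <= s < t -> right_derivative (fun s => G s - H s) s (f (seg z s) - f (seg w s)).
  by move=> /andP[s0 _]; apply: right_derivativeB; [exact: dG|exact: dH].
have := @exp_mean_value R _ _ _ (L * c) mu 0 t cGH mu0 t0 dGH.
rewrite mulr0 expR0 => /(_ _)/le_trans; apply=> [s /andP[s0 st]|].
  rewrite -mulrA; apply: HL; [exact: seg_hist|exact: seg_hist|move=> tau taur].
  apply: (le_trans (Hzw (s + tau) _)); first by lra.
  rewrite ler_wpM2l// ler_expR ler_wpM2l ?(ltW mu0)//; lra.
have -> : L / mu * c * expR (mu * t) = L * c / mu * expR (mu * t) by ring.
by rewrite ler_wpM2l ?divr_ge0 ?mulr_ge0 ?(ltW mu0)// gerBl.
Qed.

(** The Picard operator of the neutral equation: the integral of [f] along [z] is a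
choice of primitive of [t |-> f(z_t)], and [heavy_weight] makes it a
contraction. *)
Lemma neutral_primitive_exists f L phi : sup_lipschitz f L -> hist Delta phi ->
  exists x P, [/\ continuous x, forall s, - Delta <= s <= 0 -> x s = phi s,
    primitive_on_nneg (fun t => f (seg x t)) P &
    forall t, 0 <= t -> Dop A delay (seg x t) = Dop A delay phi + P t].
Proof.
move=> fL hphi; have [L0 HL] := fL; have D0 := ltW Delta_gt0.
have [mu Hmu] := @heavy_weight_exists _ _ _ A delay L
  (fun j => (andP (delay_bounds j)).1) L0.
have [mu0 Lmu _] := Hmu.
have /choice[P HP] z : exists P, continuous z -> primitive_on_nneg (fun t => f (seg z t)) P.
  have [cz|ncz] := pselect (continuous z); last by exists (fun=> 0).
  by have [P HP] := vector_primitive (functional_seg_continuous fL cz); exists P.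
pose G z t := P z (Num.max 0 t).
have cG z : continuous z -> continuous (G z).
  by move=> cz; apply: primitive_continuous (HP z cz).
have dG z t : continuous z -> 0 <= t -> right_derivative (G z) t (f (seg z t)).
  by move=> cz; apply: primitive_right_derivative (HP z cz).
have G0 z : continuous z -> G z 0 = 0 by move=> cz; rewrite /G maxxx (HP z cz).1.
have cz0 : continuous (phi \o clip Delta) by exact: clip_continuous.
have [M M0 HM] := hist_bounded D0 hphi.
have [|||||x [cx x_phi Hx]] :=
    @neutral_fixpoint R n p Delta delay A Delta_gt0 delay_bounds L mu
      ((`|f (cst 0)| + L * M) / mu) G phi Hmu hphi.
- by rewrite divr_ge0 ?(ltW mu0)// addr_ge0// mulr_ge0// ltW.
- exact: G0.
- move=> z cz; apply: (@continuous_retract R _ setT (G z) (Num.max 0)) => //.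
    exact/continuous_subspaceT/cG.
  by move=> r t; exact: max_lip.
- move=> z w c cz cw c0 Hzw m m0.
  have := integral_difference_bound fL mu0 c0 cz cw (cG _ cz) (cG _ cw)
    (fun t => dG z t cz) (fun t => dG w t cw) (fun s _ => Hzw s) (t := m) (T := m).
  rewrite m0 lexx !G0// !subr0 => /(_ isT)/le_trans; apply.
  rewrite ler_wpM2r ?expR_ge0//; have := ler_wpM2r c0 Lmu; lra.
- move=> m m0.
  have := @exp_mean_value R _ _ _ (`|f (cst 0)| + L * M) mu 0 m (cG _ cz0) mu0 m0
     (fun t tm => dG _ t cz0 (andP tm).1).
  rewrite G0// subr0 mulr0 expR0 => /(_ _)/le_trans; apply => [t /andP[t0 _]|]; last first.
    rewrite ler_wpM2l ?gerBl//.
    by rewrite divr_ge0 ?(ltW mu0)// addr_ge0// mulr_ge0// ltW.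
  apply: (@le_trans _ _ (`|f (cst 0)| + L * M)).
    have := HL (seg (phi \o clip Delta) t) (cst 0) M (seg_hist cz0) _ _.
    have := ler_normD (f (cst 0)) (f (seg (phi \o clip Delta) t) - f (cst 0)).
    rewrite addrC subrK => H1 H2; apply: (le_trans H1); rewrite lerD2l; apply: H2.
      by apply: continuous_hist => s; exact: cvg_cst.
    by move=> s _; rewrite subr0; apply: HM; exact: clip_itv.
  rewrite ler_peMr//; first by rewrite addr_ge0// mulr_ge0// ltW.
  by rewrite -expR0 ler_expR mulr_ge0// ltW.
exists x, (P x); split => //; first exact: HP.
by move=> t t0; rewrite Hx// /G max_r.
Qed.

(** Solutions are handled as functions continuous on the whole line whose [D x_t]
has right derivative [f(x_t)].  This notion is stable under time
shifts, and one-sided derivatives are all that the Dini argument and the mean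
value inequality use. *)
Definition forward_solution f x := continuous x /\
  forall t, 0 <= t -> right_derivative (fun s => Dop A delay (seg x s)) t (f (seg x t)).

Lemma Dop_seg_continuous x : continuous x -> continuous (fun s => Dop A delay (seg x s)).
Proof.
move=> cx t; rewrite (_ : (fun s => _) = (fun s => x s - delay_sum A delay x s)).
  by apply: cvgB; [exact: cx|exact: delay_sum_continuous].
by apply/funext => s; rewrite Dop_seg.
Qed.

Lemma forward_solution_shift f x a : 0 <= a -> forward_solution f x ->
  forward_solution f (fun t => x (a + t)).
Proof.
move=> a0 [cx dx]; split; first exact: continuous_shift.
have E s : seg (fun t => x (a + t)) s = seg x (a + s).
  by apply/funext => r; rewrite /seg addrA.
move=> t t0 e e0; have [d d0 Hd] := dx (a + t) (addr_ge0 a0 t0) e e0.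
by exists d => // h h0 hd; rewrite !E addrA; exact: Hd.
Qed.

Lemma forward_solution_exists f L phi : sup_lipschitz f L -> hist Delta phi ->
  exists x, [/\ forward_solution f x, forall s, - Delta <= s <= 0 -> x s = phi s &
    neutral_solution Delta A delay f phi +oo%E x].
Proof.
move=> fL hphi; have [x [P [cx x_phi HP HD]]] := neutral_primitive_exists fL hphi.
exists x; split => //.
  split=> // t t0 e e0; have [d d0 Hd] := HP.2 t t0 e e0; exists d => // h h0 hd.
  have th0 : 0 <= t + h by lra.
  have := Hd (t + h) th0; rewrite !HD// [t + h - t]addrAC subrr add0r gtr0_norm//.
  by rewrite opprD addrACA subrr add0r; exact.
split.
- exact: continuous_subspaceT.
- by move=> tau; rewrite in_itv; exact: x_phi.
exists (fun t => f (seg x t)); split => //.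
  exact/continuous_subspaceT/(functional_seg_continuous fL).
move=> t [t0 _]; apply/cvgrPdist_le => e e0; rewrite near_withinE.
have [d d0 Hd] := HP.2 t t0 e e0.
rewrite near_withinE; apply/nbhs_ballP; exists d => //= s; rewrite /ball /= => st sneq [s0 _].
rewrite distrC in st; rewrite !HD// opprD addrACA subrr add0r.
have st0 : s - t != 0 by rewrite subr_eq0.
rewrite -(ler_pM2l (_ : 0 < `|s - t|)) ?normr_gt0// -normrZ.
rewrite scalerBr scalerA divff// scale1r distrC [leRHS]mulrC; exact: Hd.
Qed.

Lemma neutral_forward_solution f L phi x : sup_lipschitz f L ->
  neutral_solution Delta A delay f phi +oo%E x ->
  exists2 y, forward_solution f y & forall t, - Delta <= t -> y t = x t.
Proof.
move=> fL [cx x_phi [g [cg dg gf]]].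
pose y t := x (Num.max (- Delta) t).
have yx t : - Delta <= t -> y t = x t by move=> h; rewrite /y max_r.
have cy : continuous y.
  apply: (continuous_retract cx) => [t|s t]; last exact: max_lip.
  by split; rewrite ?ltry// le_max lexx.
exists y => //; split=> // t t0 e e0.
have Jt s : 0 <= s -> [set t : R | 0 <= t /\ (t%:E < +oo)%E] s by move=> ?; split; rewrite ?ltry.
have Dy s : 0 <= s -> Dop A delay (seg y s) = Dop A delay (seg x s).
  move=> s0; apply: (eq_Dop A Delta_gt0 delay_bounds) => tau tauD; apply: yx.
  by have := Delta_gt0; lra.
have fy : f (seg y t) = g t.
  rewrite (gf t (Jt t t0)); apply: (eq_sup_lipschitz fL); first exact: seg_hist.
  by move=> tau tauD; apply: yx; lra.
have /cvgrPdist_le/(_ e e0) := dg t (Jt t t0).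
rewrite near_withinE near_withinE => /nbhs_ballP[d /= d0 Hd]; exists d => // h h0 hd.
have th0 : 0 <= t + h by lra.
have := Hd (t + h); rewrite /ball /= opprD addNKr normrN gtr0_norm// => /(_ hd).
have tht : t + h != t by rewrite -subr_eq0 addrAC subrr add0r gt_eqF.
move=> /(_ tht (Jt _ th0)); rewrite [t + h - t]addrAC subrr add0r => H.
rewrite !Dy// fy.
have -> : Dop A delay (seg x (t + h)) - Dop A delay (seg x t) - h *: g t =
   - (h *: (g t - h^-1 *: (Dop A delay (seg x (t + h)) - Dop A delay (seg x t)))).
  by rewrite scalerBr scalerA divff ?gt_eqF// scale1r [RHS]opprB.
by rewrite normrN normrZ gtr0_norm// mulrC ler_pM2r.
Qed.

(** The difference [z] of two solutions satisfies [z = delay_sum z + g], where [g]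
moves by at most the integral of [L] times the size of [z]; [weighted_growth]
closes the loop. *)
Lemma forward_solution_dependence f L : sup_lipschitz f L -> exists C mu, [/\ 0 <= C, 0 < mu &
  forall x y c, forward_solution f x -> forward_solution f y -> 0 <= c ->
    (forall s, - Delta <= s <= 0 -> `|x s - y s| <= c) ->
    forall t, - Delta <= t -> `|x t - y t| <= C * expR (mu * t) * c].
Proof.
move=> fL; have [L0 HL] := fL; have D0 := ltW Delta_gt0.
have [mu Hmu] := @heavy_weight_exists _ _ _ A delay L
  (fun j => (andP (delay_bounds j)).1) L0.
have [mu0 Lmu _] := Hmu; have K0 := @delay_gain_ge0 _ _ _ A.
exists (2 * (expR (mu * Delta) + (1 + delay_gain A))), mu; split=> //.
  by rewrite mulr_ge0// addr_ge0 ?expR_ge0//; lra.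
move=> x y c [cx dx] [cy dy] c0 Hc t tD.
pose z s := x s - y s.
have cz : continuous z by move=> s; apply: cvgB; [exact: cx|exact: cy].
have Dz s : z s - delay_sum A delay z s = Dop A delay (seg x s) - Dop A delay (seg y s).
  by rewrite delay_sumB !Dop_seg; apply/colP => i; rewrite !mxE; ring.
have c'0 : 0 <= (1 + delay_gain A) * c by rewrite mulr_ge0//; lra.
have -> : 2 * (expR (mu * Delta) + (1 + delay_gain A)) * expR (mu * t) * c =
  2 * (c * expR (mu * Delta) + (1 + delay_gain A) * c) * expR (mu * t) by ring.
apply: (weighted_growth delay_bounds Hmu D0 cz c0 c'0 Hc (T := t)); last by rewrite tD lexx.
move=> m m0 Hm s sT.
have := integral_difference_bound fL mu0 m0 cx cy (Dop_seg_continuous cx)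
  (Dop_seg_continuous cy) dx dy Hm sT.
rewrite -!Dz => H.
have H0 : `|z 0 - delay_sum A delay z 0| <= (1 + delay_gain A) * c.
  by rewrite -Dop0; exact: (norm_Dop_le A Delta_gt0 delay_bounds Hc).
have := ler_normD (z s - delay_sum A delay z s - (z 0 - delay_sum A delay z 0))
  (z 0 - delay_sum A delay z 0); rewrite subrK.
have E1 : 1 <= expR (mu * s) by rewrite -expR0 ler_expR mulr_ge0 ?(ltW mu0)//; lra.
have := ler_peMr c'0 E1.
have : L / mu * m * expR (mu * s) <= m / 4 * expR (mu * s).
  rewrite ler_wpM2r ?expR_ge0//; have := ler_wpM2r m0 Lmu; lra.
lra.
Qed.

Lemma forward_solution_unique f L x y : sup_lipschitz f L -> forward_solution f x -> forward_solution f y ->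
  (forall s, - Delta <= s <= 0 -> x s = y s) -> forall t, - Delta <= t -> x t = y t.
Proof.
move=> fL ix iy E t tD; have [C [mu [C0 mu0 H]]] := forward_solution_dependence fL.
apply/eqP; rewrite -subr_eq0 -normr_le0.
rewrite -[leRHS](mulr0 (C * expR (mu * t))); apply: H => // s sD.
by rewrite E// subrr normr0.
Qed.

End Solutions.

(** * Stability of the forced difference equation *)

Section DifferenceStability.
Variables (R : realType) (n p : nat) (Delta : R) (delay : 'I_p -> R) (A : 'I_p -> 'M[R]_n).
Hypothesis Delta_gt0 : 0 < Delta.
Hypothesis delay_bounds : forall j, 0 < delay j <= Delta.
Hypothesis stab : difference_UAS A delay.
Implicit Types (x y z w : R -> 'cV[R]_n).

Let S := delay_sum A delay.

(** Uniform attractivity becomes attractivity with a prescribed factor [eta] for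
histories of any size by scaling, the equation being linear. *)
Lemma homogeneous_attractive eta : 0 < eta -> exists2 T, 0 <= T &
  forall y a c, continuous y -> 0 <= a -> 0 < c -> (forall t, a <= t -> y t = S y t) ->
    (forall t, a - Delta <= t <= a -> `|y t| <= c) ->
    forall t, a + T <= t -> `|y t| <= eta * c.
Proof.
move=> eta0; pose rmax := \big[Num.max/0]_(j < p) delay j.
have rmax0 : 0 <= rmax by exact: bigmax_ge_id.
have rmaxD : rmax <= Delta.
  apply/bigmax_leP; split => [|j _]; first exact: ltW.
  by have /andP[] := delay_bounds j.
have [_ [d0 d00 Hd0]] := stab.
pose N : R := 2 * n.+1%:R.
have N0 : 0 < N by rewrite mulr_gt0.
have [|T T0 HT] := Hd0 (eta * d0 / N); first by rewrite divr_gt0 ?mulr_gt0.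
exists T => // y a c cy a0 c0 Hy Hc t aT.
(* The successor in [N] keeps it positive, and [n < N] makes the scaled history
   strictly smaller than [d0]. *)
pose k := d0 / (N * c); have k0 : 0 < k by rewrite divr_gt0 ?mulr_gt0.
pose w s := k *: y s.
have cw : continuous w by move=> s; apply: cvgZr; exact: cy.
have sw : difference_solution A delay a w.
  split; first exact: continuous_subspaceT.
  by move=> s as_; rewrite -[RHS]/(S w s) /S delay_sumZ -/S -Hy.
have small : hnorm rmax (seg w a) < d0.
  apply: (@le_lt_trans _ _ (n%:R * (k * c))).
    apply: hnorm_le_max => // s sr; rewrite /seg normrZ gtr0_norm//.
    by rewrite ler_wpM2l ?(ltW k0)// Hc//; lra.
  have -> : n%:R * (k * c) = d0 * (n%:R / N).
    by rewrite /k; field; rewrite !gt_eqF.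
  rewrite gtr_pMr// ltr_pdivrMr// mul1r /N -natr1; have : 0 <= n%:R :> R by [].
  lra.
have := HT a w a0 sw small t aT => H.
have := @norm_le_hnorm _ _ rmax rmax0 (seg w t) 0 (seg_hist cw).
rewrite lexx oppr_le0 rmax0 => /(_ isT) H1; have := le_lt_trans H1 H.
rewrite /seg addr0 normrZ gtr0_norm//.
have -> : eta * d0 / N = k * (eta * c) by rewrite /k; field; rewrite !gt_eqF.
by rewrite ltr_pM2l// => /ltW.
Qed.

(** A crude bound, growing with time, which serves on windows of fixed length. *)
Lemma difference_growth : exists2 mu, 0 < mu & forall x c b T, continuous x ->
  0 <= c -> 0 <= b -> (forall t, - Delta <= t <= 0 -> `|x t| <= c) ->
  (forall t, 0 <= t <= T -> `|x t - S x t| <= b) ->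
  forall t, - Delta <= t <= T -> `|x t| <= 2 * (c * expR (mu * Delta) + b) * expR (mu * t).
Proof.
have [mu Hmu] := @heavy_weight_exists _ _ _ A delay 0
  (fun j => (andP (delay_bounds j)).1) (lexx 0).
have [mu0 _ _] := Hmu; exists mu => // x c b T cx c0 b0 Hc Hb.
apply: (weighted_growth delay_bounds Hmu (ltW Delta_gt0) cx c0 b0 Hc) => m m0 _ t tT.
apply: (le_trans (Hb t tT)); apply: (@le_trans _ _ (b + m / 4)); first by lra.
rewrite ler_peMr//; first by lra.
by rewrite -expR0 ler_expR mulr_ge0 ?(ltW mu0)//; case/andP: tT.
Qed.

(** The solution [y] below has the history of [x], but its forcing
[(1 - min(t, 1)) D x_0] starts at the value compatible with that history and
vanishes from time 1 on.  Attractivity then makes [y] small at the end of the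
window, whereas [x - y] has zero history and a forcing of size [2 b]. *)
Lemma difference_step : exists T C, [/\ 0 < T, 0 < C &
  forall x c b, continuous x -> 0 < c -> 0 <= b ->
  (forall t, - Delta <= t <= 0 -> `|x t| <= c) ->
  (forall t, 0 <= t <= T -> `|x t - S x t| <= b) ->
  (forall t, - Delta <= t <= T -> `|x t| <= C * (c + b)) /\
  (forall t, T - Delta <= t <= T -> `|x t| <= c / 2 + C * b)].
Proof.
have [mu mu0 Hg] := difference_growth.
(* The bound of [difference_growth] for [y] at time 1, in units of [c + b]. *)
pose E := 2 * expR (mu * Delta) * expR mu.
have eD : 1 <= expR (mu * Delta) by rewrite -expR0 ler_expR mulr_ge0 ?ltW.
have e1 : 1 <= expR mu by rewrite -expR0 ler_expR ltW.
have E1 : 1 <= E.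
  by rewrite /E -mulrA; have := mulr_ege1 eD e1; lra.
have E0 : 0 < E by lra.
have [|T0 T00 HT] := @homogeneous_attractive (2 * E)^-1; first by rewrite invr_gt0; lra.
(* One unit of time to switch off the forcing, [T0] for the decay, and [Delta]
   for the whole history at time [T] to lie in the decayed part. *)
pose T := 1 + T0 + Delta; have D0 := Delta_gt0.
have T1 : 0 < T by rewrite /T; lra.
have eT : 1 <= expR (mu * T) by rewrite -expR0 ler_expR mulr_ge0 ?ltW.
pose C := 4 * expR (mu * Delta) * expR (mu * T) + 1.
have eDT := mulr_ege1 eD eT.
exists T, C; split=> //; first by rewrite /C; lra.
move=> x c b cx c0 b0 Hc Hb.
have emono t : t <= T -> expR (mu * t) <= expR (mu * T) by move=> tT; rewrite ler_expR ler_pM2l.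
split=> [t tT|].
  apply: (le_trans (Hg x c b T cx (ltW c0) b0 Hc Hb t tT)).
  apply: (@le_trans _ _ (2 * (c * expR (mu * Delta) + b) * expR (mu * T))).
    rewrite ler_wpM2l ?emono//; last by lra.
    by rewrite mulr_ge0// addr_ge0// mulr_ge0 ?expR_ge0 ?ltW.
  have : 2 * (c * expR (mu * Delta) + b) * expR (mu * T) <=
     2 * ((c + b) * expR (mu * Delta)) * expR (mu * T).
    rewrite ler_wpM2r ?expR_ge0// ler_wpM2l// mulrDl lerD2l; exact: ler_peMr.
  have : 0 <= (c + b) * (expR (mu * Delta) * expR (mu * T)).
    by rewrite mulr_ge0 ?mulr_ge0 ?expR_ge0// addr_ge0// ltW.
  rewrite /C; lra.
pose h0 := Dop A delay x.
have h0b : `|h0| <= b by rewrite /h0 Dop0; apply: Hb; rewrite lexx ltW.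
have [mu' Hmu'] := @heavy_weight_exists _ _ _ A delay 0
  (fun j => (andP (delay_bounds j)).1) (lexx 0).
have [mu'0 _ _] := Hmu'.
pose chi (t : R) := Num.min t 1.
have [||||y [cy yx Hy]] := @neutral_fixpoint R n p Delta delay A Delta_gt0 delay_bounds 0 mu'
   b (fun _ t => - (chi t *: h0)) x Hmu' (continuous_hist cx) b0.
- by move=> z _; rewrite /chi min_l// scale0r oppr0.
- move=> z _ t; apply: cvgN; apply: cvgZl.
  apply: (@continuous_retract R R^o setT idfun (fun s => chi (Num.max 0 s)) _ _ _ t) => //.
    by apply: continuous_subspaceT => s; exact: cvg_id.
  by move=> r s; apply: le_trans (min_lip _ _ _) (max_lip _ _ _).
- by move=> z w k _ _ k0 _ m m0; rewrite subrr normr0 mulr_ge0 ?expR_ge0 ?divr_ge0.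
- move=> m m0; rewrite normrN normrZ.
  have : `|chi m| <= 1 by rewrite /chi; case: (leP m 1) => h; rewrite ger0_norm.
  have : 1 <= expR (mu' * m) by rewrite -expR0 ler_expR mulr_ge0 ?(ltW mu'0).
  move=> h1 h2; apply: (@le_trans _ _ b); last by rewrite ler_peMr.
  by apply: (le_trans (ler_wpM2r (normr_ge0 _) h2)); rewrite mul1r.
have Hy' t : 0 <= t -> y t - S y t = (1 - chi t) *: h0.
  by move=> t0; rewrite /S -Dop_seg Hy// scalerBl scale1r.
have Hyb t : 0 <= t -> `|y t - S y t| <= b.
  move=> t0; rewrite Hy'// normrZ; apply: le_trans h0b; rewrite ler_piMl//.
  by rewrite /chi; case: (leP t 1) => h; rewrite ler_norml; apply/andP; split; lra.
have Hyhom t : 1 <= t -> y t = S y t.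
  by move=> t1; apply/eqP; rewrite -subr_eq0 Hy' 1?(le_trans ler01)// /chi min_r// subrr scale0r.
have Hyc t : - Delta <= t <= 0 -> `|y t| <= c by move=> tD; rewrite yx// Hc.
have Hy1 t : 1 - Delta <= t <= 1 -> `|y t| <= E * (c + b).
  move=> t1; apply: (le_trans (Hg y c b 1 cy (ltW c0) b0 Hyc _ t _)).
  - by move=> s /andP[s0 _]; exact: Hyb.
  - lra.
  apply: (@le_trans _ _ (2 * (c * expR (mu * Delta) + b) * expR mu)).
    rewrite ler_wpM2l//; last by rewrite ler_expR -[leRHS]mulr1 ler_pM2l//; lra.
    by rewrite mulr_ge0// addr_ge0// mulr_ge0 ?expR_ge0 ?ltW.
  have : 2 * (c * expR (mu * Delta) + b) * expR mu <= 2 * ((c + b) * expR (mu * Delta)) * expR mu.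
    rewrite ler_wpM2r ?expR_ge0// ler_wpM2l// mulrDl lerD2l; exact: ler_peMr.
  rewrite /E; lra.
have Hylate t : 1 + T0 <= t -> `|y t| <= (c + b) / 2.
  move=> t1; have -> : (c + b) / 2 = (2 * E)^-1 * (E * (c + b)).
    by field; rewrite gt_eqF.
  by apply: (HT y 1) => //; rewrite mulr_gt0// ltr_pwDl.
have Hw t : 0 <= t <= T -> `|x t - y t| <= 4 * b * expR (mu * T).
  move=> tT; pose w s := x s - y s.
  have cw : continuous w by move=> s; apply: cvgB; [exact: cx|exact: cy].
  have Dw s : 0 <= s <= T -> `|w s - S w s| <= 2 * b.
    move=> sT; rewrite /S delay_sumB /w.
    have -> : x s - y s - (delay_sum A delay x s - delay_sum A delay y s) =
       (x s - S x s) - (y s - S y s) by apply/colP => i; rewrite !mxE; ring.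
    apply: (le_trans (ler_normB _ _)); have := Hb s sT; have := Hyb s (andP sT).1; lra.
  have := Hg w 0 (2 * b) T cw (lexx 0) ltac:(lra) _ Dw t ltac:(lra).
  rewrite mul0r add0r => /(_ _)/le_trans; apply => [s sD|].
    by rewrite /w yx// subrr normr0.
  have -> : 2 * (2 * b) = 4 * b by ring.
  by rewrite ler_wpM2l ?mulr_ge0// emono//; case/andP: tT.
move=> t tT; have tT' : 1 + T0 <= t by move: tT; rewrite /T; lra.
have H1 := Hylate t tT'; have H2 := Hw t ltac:(lra).
have := ler_normD (y t) (x t - y t); rewrite addrC subrK.
have : 4 * b * expR (mu * T) <= 4 * b * (expR (mu * Delta) * expR (mu * T)).
  by rewrite ler_wpM2l ?mulr_ge0// ler_peMl ?expR_ge0.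
rewrite /C; lra.
Qed.

(** The windows of [difference_step] are iterated: as [mu <= 1 / (4 T)], the
forcing keeps at least the fraction 3/4 of its bound over a window, so the bound
[C2 c e^{- mu k T}] on the history at time [k T] survives a halving plus [C1] times the forcing. *)
Lemma difference_exp_stable : exists C mu0, [/\ 0 < C, 0 < mu0 &
  forall mu x c, 0 <= mu <= mu0 -> continuous x -> 0 < c ->
    (forall t, - Delta <= t <= 0 -> `|x t| <= c) ->
    (forall t, 0 <= t -> `|x t - S x t| <= c * expR (- mu * t)) ->
    forall t, 0 <= t -> `|x t| <= C * c * expR (- mu * t)].
Proof.
have [T [C1 [T0 C10 Hstep]]] := difference_step.
pose C2 := 4 * C1 + 1.
exists (2 * (C1 * (C2 + 1))), (4 * T)^-1; split.
- by rewrite !mulr_gt0// /C2; lra.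
- by rewrite invr_gt0 mulr_gt0.
move=> mu x c /andP[mu0 muT] cx c0 Hc Hh.
have q34 : 3 / 4 <= expR (- mu * T).
  have := expR_ge1Dx (- mu * T); have : mu * T <= 4^-1.
    have -> : 4^-1 = (4 * T)^-1 * T by field; rewrite gt_eqF.
    by rewrite ler_pM2r.
  lra.
pose q (k : nat) := expR (- mu * (k%:R * T)).
have q0 k : 0 < q k by exact: expR_gt0.
have qS k : 3 / 4 * q k <= q k.+1.
  have E : - mu * (k.+1%:R * T) = - mu * T + - mu * (k%:R * T) by rewrite -natr1; ring.
  by rewrite /q E expRD ler_wpM2r// expR_ge0.
have cshift a : continuous (fun t => x (a + t)) by exact: continuous_shift.
have Hhk k t : 0 <= t <= T ->
    `|x (k%:R * T + t) - S (fun s => x (k%:R * T + s)) t| <= c * q k.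
  move=> /andP[t0 _]; rewrite /S delay_sum_shift.
  have kT0 : 0 <= k%:R * T by rewrite mulr_ge0// ltW.
  apply: (le_trans (Hh _ (addr_ge0 kT0 t0))); rewrite ler_pM2l// ler_expR !mulNr lerN2.
  by rewrite ler_wpM2l// lerDl.
have C20 : 0 < C2 by rewrite /C2; lra.
have Hk k t : - Delta <= t <= 0 -> `|x (k%:R * T + t)| <= C2 * c * q k.
  elim: k t => [|k IH] t tD.
    rewrite /q !mul0r mulr0 expR0 mulr1 add0r; apply: (le_trans (Hc t tD)).
    by rewrite ler_peMl ?(ltW c0)// /C2; lra.
  have [_] := Hstep (fun s => x (k%:R * T + s)) (C2 * c * q k) (c * q k) (cshift _)
     (mulr_gt0 (mulr_gt0 C20 c0) (q0 k)) (ltW (mulr_gt0 c0 (q0 k))) IH (Hhk k).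
  move=> /(_ (T + t)) H; rewrite -natr1 mulrDl mul1r -addrA; apply: (le_trans (H _)).
    by lra.
  apply: (@le_trans _ _ (C2 * c * (3 / 4 * q k))); last by rewrite ler_pM2l// mulr_gt0.
  have := mulr_gt0 c0 (q0 k); rewrite /C2; lra.
move=> t t0; pose k := Num.truncn (t / T).
have /andP[k1 k2] : (k%:R <= t / T < k.+1%:R) by apply: truncn_itv; rewrite divr_ge0// ltW.
rewrite ler_pdivlMr// in k1; rewrite ltr_pdivrMr// -natr1 mulrDl mul1r in k2.
have [+ _] := Hstep (fun s => x (k%:R * T + s)) (C2 * c * q k) (c * q k) (cshift _)
     (mulr_gt0 (mulr_gt0 C20 c0) (q0 k)) (ltW (mulr_gt0 c0 (q0 k))) (Hk k) (Hhk k).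
move=> /(_ (t - k%:R * T)); rewrite [_ + (t - _)]addrC subrK => H.
apply: (le_trans (H _)); first by have := Delta_gt0; lra.
have qt : q k <= 2 * expR (- mu * t).
  have : q k * (3 / 4) <= expR (- mu * t).
    apply: (@le_trans _ _ (q k * expR (- mu * T))); first by rewrite ler_pM2l.
    rewrite /q -expRD ler_expR -mulrDr !mulNr lerN2 ler_wpM2l//; lra.
  have := expR_gt0 (- mu * t); lra.
have -> : C1 * (C2 * c * q k + c * q k) = C1 * (C2 + 1) * c * q k by ring.
have -> : 2 * (C1 * (C2 + 1)) * c * expR (- mu * t) =
   C1 * (C2 + 1) * c * (2 * expR (- mu * t)) by ring.
by rewrite ler_wpM2l// !mulr_ge0 ?(ltW c0) ?(ltW C10)//; lra.
Qed.

End DifferenceStability.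

(** * The functional derivative along solutions *)

Section Lyapunov.
Variables (R : realType) (n p : nat) (Delta : R) (delay : 'I_p -> R) (A : 'I_p -> 'M[R]_n).
Hypothesis Delta_gt0 : 0 < Delta.
Hypothesis delay_bounds : forall j, 0 < delay j <= Delta.
Variables (f : (R -> 'cV[R]_n) -> 'cV[R]_n) (Lf : R).
Hypothesis f_lip : sup_lipschitz Delta f Lf.
Implicit Types (x y z w : R -> 'cV[R]_n) (phi psi : R -> 'cV[R]_n).

(** For [h] smaller than all delays the extension only looks back at known values:
on the new part [tau > - h] it equals
[D phi + (tau + h) f phi + delay_sum x (tau + h)], while
[x (tau + h) = D x_{tau + h} + delay_sum x (tau + h)].  The difference is the
error term in the right derivative of [D x_t] at 0. *)
Lemma phi_ext_consistent x phi : forward_solution delay A f x -> hist Delta phi ->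
  (forall s, - Delta <= s <= 0 -> x s = phi s) ->
  forall e, 0 < e -> exists2 d, 0 < d & forall h, 0 < h -> h < d ->
    hist Delta (phi_ext A delay f phi h) /\
    forall tau, - Delta <= tau <= 0 -> `|seg x h tau - phi_ext A delay f phi h tau| <= e * h.
Proof.
move=> [cx dx] hphi x_phi e e0; have D0 := Delta_gt0.
have [d1 d10 Hd1] := finite_pos_min (fun j => (andP (delay_bounds j)).1).
have [d2 d20 Hd2] := dx 0 (lexx 0) e e0.
have fphi : f (seg x 0) = f phi.
  apply: (eq_sup_lipschitz f_lip); first exact: seg_hist.
  by move=> s sD; rewrite /seg add0r x_phi.
have Dphi : Dop A delay (seg x 0) = Dop A delay phi.
  by apply: (eq_Dop A Delta_gt0 delay_bounds) => s sD; rewrite /seg add0r x_phi.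
exists (Num.min d1 d2); first by rewrite lt_min d10.
move=> h h0; rewrite lt_min => /andP[hd1 hd2].
have hdelay j : h < delay j by exact: lt_le_trans hd1 (Hd1 j).
have early tau : - Delta <= tau -> tau <= - h -> phi_ext A delay f phi h tau = x (tau + h).
  by move=> t1 t2; rewrite /phi_ext t2 x_phi//; lra.
have late tau : - h < tau -> tau <= 0 -> phi_ext A delay f phi h tau =
    Dop A delay phi + (tau + h) *: f phi + delay_sum A delay x (tau + h).
  move=> t1 t2; rewrite /phi_ext leNgt t1 /= [X in _ - X + _]/Dop.
  rewrite {1}/phi_star (_ : (0 <= _) = false); last by apply/negbTE; rewrite -ltNge; lra.
  rewrite opprB addrA subrK; congr (_ + _); apply: eq_bigr => j _; congr (_ *m _).
  have := hdelay j; have := delay_bounds j => db hj.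
  rewrite /phi_star (_ : (- delay j <= _) = true); last by lra.
  by rewrite addrC x_phi//; lra.
split; last first.
  move=> tau /andP[t1 t2]; have [th|th] := leP tau (- h).
    by rewrite early// /seg [h + tau]addrC subrr normr0 mulr_ge0// ltW.
  rewrite late// -fphi -Dphi /seg [h + tau]addrC.
  have th0 : 0 < tau + h by lra.
  have := Hd2 (tau + h) th0 ltac:(lra); rewrite add0r Dop_seg.
  have -> : x (tau + h) - delay_sum A delay x (tau + h) - Dop A delay (seg x 0) - (tau + h) *: f (seg x 0)
   = x (tau + h) - (Dop A delay (seg x 0) + (tau + h) *: f (seg x 0) + delay_sum A delay x (tau + h)).
    by apply/colP => i; rewrite !mxE; ring.
  by move/le_trans; apply; rewrite ler_pM2l//; lra.
pose m tau := Num.max 0 (tau + h).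
(* Both branches of [phi_ext] in one formula, continuous on the whole line. *)
pose g tau := x (Num.min (tau + h) 0) + m tau *: f phi +
   (delay_sum A delay x (m tau) - delay_sum A delay x 0).
apply: (@hist_eq _ _ _ g) => [tau /andP[t1 t2]|].
  have [th|th] := leP tau (- h).
    by rewrite early// /g /m max_l ?min_l ?scale0r ?subrr ?addr0//; lra.
  rewrite late// /g /m max_r ?min_r; [|lra|lra].
  rewrite x_phi ?(zero_in_hist Delta_gt0)//.
  rewrite Dop0 (@eq_delay_sum _ _ _ _ _ phi x 0); last first.
    by move=> j; rewrite x_phi//; exact: delay_in_hist.
  by apply/colP => i; rewrite !mxE; ring.
apply: continuous_hist.
have lip_add (a b : R) : `|(a + h) - (b + h)| <= `|a - b| by rewrite opprD addrACA subrr addr0.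
have cm (W : normedModType R) (q : R -> W) : continuous q -> continuous (q \o m).
  move=> cq; apply: (@continuous_retract R _ setT q) => //; first exact: continuous_subspaceT.
  by move=> r s; apply: le_trans (max_lip _ _ _) (lip_add _ _).
move=> tau; apply: cvgD; first apply: cvgD.
- apply: (@continuous_retract R _ setT x (fun s => Num.min (s + h) 0)) => //.
    exact: continuous_subspaceT.
  by move=> r s; apply: le_trans (min_lip _ _ _) (lip_add _ _).
- apply: cvgZl; apply: (cm R^o idfun) => s; exact: cvg_id.
- apply: cvgB; last exact: cvg_cst.
  by apply: cm; exact: delay_sum_continuous.
Qed.

Lemma Dplus_le (V : (R -> 'cV[R]_n) -> R) phi c :
  (forall e, 0 < e -> exists2 d, 0 < d & forall h, 0 < h -> h < d ->
     V (phi_ext A delay f phi h) - V phi <= (c + e) * h) ->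
  (Dplus A delay f V phi <= c%:E)%E.
Proof.
move=> H; apply/lee_addgt0Pr => e e0; have [d d0 Hd] := H e e0.
rewrite /Dplus limf_esupE.
apply: (@le_trans _ _ (ereal_sup ((fun h : R =>
   ((V (phi_ext A delay f phi h) - V phi) / h)%:E) @` [set h | 0 < h < d]))).
  apply: ereal_inf_lbound; exists [set h : R | 0 < h < d] => //=.
  rewrite /at_right /within /=; near=> h => h0; rewrite /= h0 /=.
  by near: h; exact: lt_nbhsl.
apply: ge_ereal_sup => _ [h /= /andP[h0 hd] <-].
by rewrite -EFinD lee_fin ler_pdivrMr// Hd.
Unshelve. all: by end_near. Qed.

Lemma Dplus_ge (V : (R -> 'cV[R]_n) -> R) phi c : (Dplus A delay f V phi <= c%:E)%E ->
  forall e, 0 < e -> exists2 d, 0 < d & forall h, 0 < h -> h < d ->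
     V (phi_ext A delay f phi h) - V phi <= (c + e) * h.
Proof.
rewrite /Dplus limf_esupE => H e e0.
have : (c%:E < (c + e)%:E)%E by rewrite lte_fin ltrDl.
move=> /(le_lt_trans H)/ereal_inf_lt[_ [U /= HU <-] Hsup].
move: HU; rewrite /at_right /within /= => /nbhs_ballP[d /= d0 Hd].
exists d => // h h0 hd; rewrite -ler_pdivrMr// -lee_fin.
apply: le_trans (ltW Hsup); apply: ereal_sup_ubound; exists h => //.
by apply: Hd => //; rewrite /ball /= sub0r normrN gtr0_norm.
Qed.

(** [e^{c t} V(x_t)] has nonpositive Dini derivative, by [phi_ext_consistent] and
the inequality [e^{c h} (1 - c h) <= 1]. *)
Lemma lyapunov_decay (V : (R -> 'cV[R]_n) -> R) LV c x : 0 < c ->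
  @sup_lipschitz R n Delta R^o V LV -> (forall phi, hist Delta phi -> 0 <= V phi) ->
  (forall phi, hist Delta phi -> (Dplus A delay f V phi <= (- c * V phi)%:E)%E) ->
  forward_solution delay A f x -> forall t, 0 <= t -> V (seg x t) <= expR (- c * t) * V (seg x 0).
Proof.
move=> c0 Vlip V0 DV ix t t0; have [cx _] := ix; have [LV0 HV] := Vlip.
have D0 := Delta_gt0.
pose u s := expR (c * s) * V (seg x s).
suff : u t <= u 0.
  rewrite /u mulr0 expR0 mul1r -[- c * t]/(- c * t) mulNr expRN => H.
  by rewrite mulrC ler_pdivlMr ?expR_gt0// mulrC.
apply: dini_nonincreasing => //.
  move=> s; apply: cvgM; last exact: (functional_seg_continuous Vlip cx).
  apply: continuous_comp; first by apply: cvgM; [exact: cvg_cst|exact: cvg_id].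
  exact: continuous_expR.
move=> s /andP[s0 _] e e0.
pose K := expR (c * (s + 1)); have K0 : 0 < K by exact: expR_gt0.
pose e1 := e / (K * (1 + LV)).
have e10 : 0 < e1 by rewrite divr_gt0// mulr_gt0//; lra.
have hs : hist Delta (seg x s) by exact: seg_hist.
have [d1 d10 Hd1] := Dplus_ge (DV _ hs) e10.
have [d2 d20 Hd2] := phi_ext_consistent (forward_solution_shift s0 ix) hs (fun _ _ => erefl) e10.
exists (Num.min 1 (Num.min d1 d2)); first by rewrite !lt_min ltr01 d10.
move=> h h0; rewrite !lt_min => /and3P[h1 hd1 hd2].
have H1 := Hd1 h h0 hd1; have [he H2] := Hd2 h h0 hd2.
have := HV (seg x (s + h)) (phi_ext A delay f (seg x s) h) (e1 * h) (seg_hist cx) he.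
move=> /(_ _)/(le_trans (ler_norm _)) H3.
have {}H3 : V (seg x (s + h)) <= (1 - c * h) * V (seg x s) + (1 + LV) * e1 * h.
  have : V (seg x (s + h)) - V (phi_ext A delay f (seg x s) h) <= LV * (e1 * h).
    by apply: H3 => tau tauD; have := H2 tau tauD; rewrite /seg addrA.
  lra.
have V_ge0 := V0 _ hs.
have E : expR (c * (s + h)) = expR (c * s) * expR (c * h) by rewrite mulrDr expRD.
have E1 : expR (c * h) * (1 - c * h) <= 1.
  have := expR_ge1Dx (- (c * h)); rewrite expRN => H.
  by rewrite mulrC -ler_pdivlMr ?expR_gt0// div1r.
have E2 : expR (c * (s + h)) <= K by rewrite /K ler_expR ler_pM2l//; lra.
have := ler_wpM2l (expR_ge0 (c * (s + h))) H3; rewrite /u.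
have : expR (c * (s + h)) * ((1 - c * h) * V (seg x s)) <= expR (c * s) * V (seg x s).
  rewrite E mulrA -[expR (c * s) * _ * _]mulrA ler_wpM2r//.
  by rewrite ler_piMr// expR_ge0.
have : expR (c * (s + h)) * ((1 + LV) * e1 * h) <= K * ((1 + LV) * e1 * h).
  apply: ler_wpM2r E2; apply: mulr_ge0 (ltW h0); apply: mulr_ge0 (ltW e10); lra.
have -> : K * ((1 + LV) * e1 * h) = e * h.
  have L1 : 0 < 1 + LV by lra.
  by rewrite /e1; field; rewrite !lt0r_neq0.
lra.
Qed.

End Lyapunov.

(** * From a Lyapunov functional to exponential stability *)

Section Sufficiency.
Variables (R : realType) (n p : nat) (Delta : R) (delay : 'I_p -> R) (A : 'I_p -> 'M[R]_n).
Hypothesis n_gt0 : (0 < n)%N.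
Hypothesis Delta_gt0 : 0 < Delta.
Hypothesis delay_bounds : forall j, 0 < delay j <= Delta.
Variables (f : (R -> 'cV[R]_n) -> 'cV[R]_n).
Hypothesis f_lip : globally_lipschitz Delta (@enorm R n) f.

Lemma sup_lipschitz_of_enorm : exists L, sup_lipschitz Delta f L.
Proof.
have [L L0 HL] := lipschitz_max (ltW Delta_gt0) f_lip.
exists L; split=> // phi psi c h1 h2 H; apply: le_trans (norm_le_enorm _) _; exact: HL.
Qed.

Lemma lyapunov_zero_GES (V Na : (R -> 'cV[R]_n) -> R) (a1 a2 a3 a4 : R) :
  difference_UAS A delay ->
  (forall phi, hist Delta phi -> 0 <= V phi) ->
  globally_lipschitz Delta (fun v : R => `|v|) V ->
  0 < a1 -> 0 < a2 -> 0 < a3 -> 0 < a4 ->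
  (forall phi, hist Delta phi ->
     [/\ a1 * enorm (Dop A delay phi) <= V phi <= a2 * Na phi,
         (Dplus A delay f V phi <= (- a3 * Na phi)%:E)%E
       & Na phi <= a4 * hnorm Delta phi]) ->
  zero_GES Delta A delay f.
Proof.
move=> stab V0 Vlip a10 a20 a30 a40 HV.
have D0 := ltW Delta_gt0; have [Lf flip] := sup_lipschitz_of_enorm.
have [LV LV0 HLV] := lipschitz_max D0 Vlip.
have Vsup : @sup_lipschitz R n Delta R^o V LV by split.
have [C [mu0 [C0 mu00 Hdiff]]] := difference_exp_stable Delta_gt0 delay_bounds stab.
pose c := a3 / a2; have c0 : 0 < c by rewrite divr_gt0.
pose lam := Num.min c mu0.
have lam0 : 0 < lam by rewrite lt_min c0.
pose B := 1 + a2 * a4 / a1.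
have B1 : 0 < a2 * a4 / a1 by rewrite divr_gt0 ?mulr_gt0.
have B0 : 0 < B by rewrite /B; lra.
have DV phi : hist Delta phi -> (Dplus A delay f V phi <= (- c * V phi)%:E)%E.
  move=> hphi; have [/andP[_ Va] HD _] := HV phi hphi.
  apply: (le_trans HD); rewrite lee_fin !mulNr lerN2.
  by rewrite /c -mulrA ler_pM2l// ler_pdivrMl.
exists (n%:R * (C * B)), lam; split => //; first by rewrite !mulr_gt0// ltr0n.
move=> xi hxi; split; first by have [x [_ _ Hx]] := forward_solution_exists A Delta_gt0 delay_bounds flip hxi; exists x.
move=> x Hx t t0; have [y iy yx] := neutral_forward_solution Delta_gt0 delay_bounds flip Hx.
have [_ x_xi _] := Hx; have [cy _] := iy.
have y_xi s : - Delta <= s <= 0 -> y s = xi s.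
  by move=> sD; rewrite yx ?x_xi ?in_itv//; case/andP: sD.
pose N := hnorm Delta xi; have N0 : 0 <= N by exact: hnorm_ge0.
pose K := n%:R * (C * B) * expR (- lam * t).
have K0 : 0 < K by rewrite !mulr_gt0 ?expR_gt0// ltr0n.
suff H e : 0 < e -> enorm (x t) <= K * (N + e).
  apply/ler_addgt0Pr => e e0; have := H (e / K) (divr_gt0 e0 K0).
  by rewrite mulrDr [K * (e / K)]mulrC divfK ?gt_eqF.
move=> e0; have Ne : 0 < N + e by rewrite ltr_wpDl.
have -> : K * (N + e) = n%:R * (C * (B * (N + e)) * expR (- lam * t)) by rewrite /K; ring.
apply: le_trans (enorm_le _) _; rewrite ler_wpM2l// -yx; last by lra.
apply: Hdiff => //; first by rewrite (ltW lam0) ge_min lexx orbT.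
- by rewrite mulr_gt0.
- move=> s sD; rewrite y_xi//; apply: le_trans (norm_le_hnorm D0 hxi sD) _.
  apply: (@le_trans _ _ (N + e)); first by rewrite -/N; lra.
  by rewrite ler_peMl ?(ltW Ne)// /B; lra.
move=> s s0; rewrite -Dop_seg.
apply: le_trans (norm_le_enorm _) _.
have [/andP[H1 _] _ _] := HV (seg y s) (seg_hist cy).
have H2 := lyapunov_decay Delta_gt0 delay_bounds flip c0 Vsup V0 DV iy s0.
have [/andP[_ H3] _ H4] := HV (seg y 0) (seg_hist cy).
have H5 : hnorm Delta (seg y 0) <= N.
  by apply: hnorm_le => // r rD; rewrite /seg add0r y_xi//; exact: hnorm_ge.
have H6 : V (seg y 0) <= a2 * a4 * N.
  apply: le_trans H3 _; rewrite -mulrA ler_pM2l//; apply: le_trans H4 _.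
  by rewrite ler_pM2l.
have H7 : enorm (Dop A delay (seg y s)) <= a2 * a4 / a1 * N * expR (- c * s).
  rewrite -(ler_pM2l a10); apply: le_trans H1 _; apply: le_trans H2 _.
  have -> : a1 * (a2 * a4 / a1 * N * expR (- c * s)) = expR (- c * s) * (a2 * a4 * N).
    by field; rewrite gt_eqF.
  by rewrite ler_wpM2l ?expR_ge0.
apply: le_trans H7 _; apply: ler_pM; rewrite ?expR_ge0//.
- by rewrite mulr_ge0 ?(ltW B1).
- apply: ler_pM; rewrite ?(ltW B1)// /B; lra.
- by rewrite ler_expR !mulNr lerN2 ler_wpM2r// ge_min lexx.
Qed.

End Sufficiency.

(** * The converse Lyapunov functional *)

Section SupNorm.
Variables (R : realType) (n : nat) (r : R).
Hypothesis r0 : 0 <= r.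
Implicit Types phi psi : R -> 'cV[R]_n.

(** The semi-norm of the converse theorem.  With the max norm on vectors in place of
the Euclidean one, the triangle inequality is immediate. *)
Definition sup_norm phi : R := sup [set `|phi tau| | tau in `[- r, 0]].

Lemma sup_norm_ge phi t : hist r phi -> - r <= t <= 0 -> `|phi t| <= sup_norm phi.
Proof.
move=> /(hist_bounded r0)[M M0 HM] tr; apply: sup_ubound; last first.
  by exists t => //=; rewrite in_itv.
by exists M => _ [s /= sr <-]; apply: HM; rewrite in_itv in sr.
Qed.

Lemma sup_norm_le phi c : (forall t, - r <= t <= 0 -> `|phi t| <= c) -> sup_norm phi <= c.
Proof.
move=> H; apply: sup_le_ub.
  by exists `|phi 0|; exists 0 => //=; rewrite in_itv /= lexx oppr_le0 r0.
by move=> _ [t /= tr <-]; apply: H; rewrite in_itv in tr.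
Qed.

Lemma sup_norm_ge0 phi : hist r phi -> 0 <= sup_norm phi.
Proof.
move=> h; apply: le_trans (sup_norm_ge (t := 0) h _); first exact: normr_ge0.
by rewrite lexx oppr_le0 r0.
Qed.

Lemma sup_norm_le_hnorm phi : hist r phi -> sup_norm phi <= hnorm r phi.
Proof. by move=> h; apply: sup_norm_le => t; exact: norm_le_hnorm. Qed.

Lemma hnorm_le_sup_norm phi : hist r phi -> hnorm r phi <= n%:R * sup_norm phi.
Proof. by move=> h; apply: hnorm_le_max => // t; exact: sup_norm_ge. Qed.

Lemma sup_norm_seminorm : seminorm_on_hist r sup_norm.
Proof.
split=> [phi|c phi h|phi psi h1 h2]; first exact: sup_norm_ge0.
- apply/eqP; rewrite eq_le; apply/andP; split.
    apply: sup_norm_le => t tr; rewrite /= normrZ ler_wpM2l//; exact: sup_norm_ge.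
  have [->|c0] := eqVneq c 0.
    rewrite normr0 mul0r; apply: sup_norm_ge0; apply: continuous_hist => t.
    have -> : 0 *: phi = cst 0 by apply/funext => s; exact: scale0r.
    exact: cvg_cst.
  have hc : hist r (c *: phi).
    move=> t; apply: cvgZr; exact: h.
  have nc0 : 0 < `|c| by rewrite normr_gt0.
  rewrite mulrC -ler_pdivlMr//; apply: sup_norm_le => t tr.
  rewrite ler_pdivlMr// mulrC -normrZ; exact: (sup_norm_ge hc tr).
- apply: sup_norm_le => t tr; apply: le_trans (ler_normD _ _) _.
  by apply: lerD; exact: sup_norm_ge.
Qed.

End SupNorm.

Section Necessity.
Variables (R : realType) (n p : nat) (Delta : R) (delay : 'I_p -> R) (A : 'I_p -> 'M[R]_n).
Hypothesis Delta_gt0 : 0 < Delta.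
Hypothesis delay_bounds : forall j, 0 < delay j <= Delta.
Variables (f : (R -> 'cV[R]_n) -> 'cV[R]_n) (Lf : R).
Hypothesis f_lip : sup_lipschitz Delta f Lf.
Implicit Types (x : R -> 'cV[R]_n) (phi psi : R -> 'cV[R]_n).

Let N := @sup_norm R n Delta.

Variables (X : (R -> 'cV[R]_n) -> R -> 'cV[R]_n) (M lam : R).
Hypothesis M1 : 1 <= M.
Hypothesis lam0 : 0 < lam.
Hypothesis X_solves : forall phi, hist Delta phi -> forward_solution delay A f (X phi).
Hypothesis X_init : forall phi, hist Delta phi ->
  forall s, - Delta <= s <= 0 -> X phi s = phi s.
Hypothesis X_decay : forall phi, hist Delta phi -> forall t tau, 0 <= t ->
  - Delta <= tau <= 0 -> `|X phi (t + tau)| <= M * expR (- (2 * lam) * t) * N phi.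

(** The supremum over [tau] makes [peak] depend on whole histories, so that it
dominates the sup norm of [phi] at [t = 0]. *)
Definition peak_set phi : set R := [set v | exists t tau,
  [/\ 0 <= t, - Delta <= tau <= 0 & v = expR (lam * t) * `|X phi (t + tau)|]].
Definition peak phi : R := sup (peak_set phi).

(** Half of the decay rate [2 lam] pays for the weight of [peak]; the other half
makes the late terms negligible, on which [peak_lipschitz] depends. *)
Lemma weighted_decay phi t tau : hist Delta phi -> 0 <= t -> - Delta <= tau <= 0 ->
  expR (lam * t) * `|X phi (t + tau)| <= M * expR (- lam * t) * N phi.
Proof.
move=> h t0 tD; apply: le_trans (ler_wpM2l (expR_ge0 _) (X_decay h t0 tD)) _.
have -> : - lam * t = lam * t + - (2 * lam) * t by ring.
rewrite expRD le_eqVlt; apply/orP; left; apply/eqP; ring.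
Qed.

Lemma peak_ge phi t tau : hist Delta phi -> 0 <= t -> - Delta <= tau <= 0 ->
  expR (lam * t) * `|X phi (t + tau)| <= peak phi.
Proof.
move=> h t0 tD; apply: sup_ubound; last by exists t, tau.
have N0 : 0 <= N phi by apply: sup_norm_ge0 h; exact: ltW.
have M0 : 0 <= M by exact: le_trans M1.
exists (M * N phi) => _ [s [r [s0 rD ->]]]; apply: le_trans (weighted_decay h s0 rD) _.
rewrite ler_wpM2r// ler_piMr// -expR0 ler_expR mulNr oppr_le0 mulr_ge0//; exact: ltW.
Qed.

Lemma peak_le phi c : (forall t tau, 0 <= t -> - Delta <= tau <= 0 ->
  expR (lam * t) * `|X phi (t + tau)| <= c) -> peak phi <= c.
Proof.
move=> H; apply: sup_le_ub.
  exists (expR (lam * 0) * `|X phi (0 + 0)|), 0, 0; split=> //.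
  exact: (zero_in_hist Delta_gt0).
by move=> _ [t [tau [t0 tD ->]]]; exact: H.
Qed.

Lemma sup_norm_le_peak phi : hist Delta phi -> N phi <= peak phi.
Proof.
move=> h; apply: sup_norm_le => [|t tD]; first exact: ltW.
by have := peak_ge h (lexx 0) tD; rewrite mulr0 expR0 mul1r add0r X_init.
Qed.

Lemma peak_le_sup_norm phi : hist Delta phi -> peak phi <= M * N phi.
Proof.
move=> h; apply: peak_le => t tau t0 tD; apply: le_trans (weighted_decay h t0 tD) _.
have N0 : 0 <= N phi by apply: sup_norm_ge0 h; exact: ltW.
have M0 : 0 <= M by exact: le_trans M1.
rewrite ler_wpM2r// ler_piMr// -expR0 ler_expR mulNr oppr_le0 mulr_ge0//; exact: ltW.
Qed.

(** Up to the time [T] after which [M e^{- lam t} <= 1], the solution map is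
Lipschitz with a fixed constant.  Later terms are at most the norm of [phi],
which is 1-Lipschitz and dominated by [peak]. *)
Lemma peak_lipschitz : exists LV, @sup_lipschitz R n Delta R^o peak LV.
Proof.
have [C [mu [C0 mu0 Hdep]]] := forward_solution_dependence A Delta_gt0 delay_bounds f_lip.
pose T := M / lam; have T0 : 0 <= T by rewrite divr_ge0 ?(ltW lam0)// (le_trans _ M1).
have HT t : T <= t -> M * expR (- lam * t) <= 1.
  move=> Tt; rewrite mulNr expRN ler_pdivrMr ?expR_gt0// mul1r.
  apply: le_trans (expR_ge1Dx (lam * t)).
  have : M <= lam * t by rewrite mulrC -ler_pdivrMr.
  lra.
pose LV := expR (lam * T) * (C * expR (mu * T)) + 1.
have LV1 : 0 <= expR (lam * T) * (C * expR (mu * T)) by rewrite !mulr_ge0 ?expR_ge0.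
exists LV; split; first by rewrite /LV; lra.
have half phi psi c : hist Delta phi -> hist Delta psi -> 0 <= c ->
    (forall t, - Delta <= t <= 0 -> `|phi t - psi t| <= c) -> peak phi <= peak psi + LV * c.
  move=> h1 h2 c0 Hc; apply: peak_le => t tau t0 tD.
  have [tT|/ltW Tt] := leP t T.
    have H1 := peak_ge h2 t0 tD.
    have H2 : `|X phi (t + tau) - X psi (t + tau)| <= C * expR (mu * T) * c.
      apply: le_trans (Hdep _ _ c (X_solves h1) (X_solves h2) c0 _ _ _) _.
      - by move=> s sD; rewrite !X_init// Hc.
      - by lra.
      by rewrite ler_wpM2r// ler_wpM2l// ler_expR ler_pM2l//; lra.
    have H3 : `|X phi (t + tau)| <= `|X psi (t + tau)| + C * expR (mu * T) * c.
      have := ler_normD (X psi (t + tau)) (X phi (t + tau) - X psi (t + tau)).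
      by rewrite addrC subrK; lra.
    apply: le_trans (ler_wpM2l (expR_ge0 _) H3) _; rewrite mulrDr; apply: lerD => //.
    apply: (@le_trans _ _ (expR (lam * T) * (C * expR (mu * T) * c))).
      by rewrite ler_wpM2r ?mulr_ge0 ?expR_ge0// ler_expR ler_pM2l.
    rewrite /LV; lra.
  apply: le_trans (weighted_decay h1 t0 tD) _.
  have N0 : 0 <= N phi by apply: sup_norm_ge0 h1; exact: ltW.
  apply: (@le_trans _ _ (N phi)); first by rewrite ler_piMl// HT.
  have H4 : N phi <= N psi + c.
    apply: sup_norm_le => [|s sD]; first exact: ltW.
    have := ler_normD (psi s) (phi s - psi s); rewrite addrC subrK.
    have := Hc s sD; have := sup_norm_ge (ltW Delta_gt0) h2 sD; rewrite -/N; lra.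
  have := sup_norm_le_peak h2; have := mulr_ge0 LV1 c0; rewrite /LV; lra.
move=> phi psi c h1 h2 Hc.
have c0 : 0 <= c by apply: le_trans (Hc 0 (zero_in_hist Delta_gt0)).
have H1 := half _ _ _ h1 h2 c0 Hc.
have H2 : peak psi <= peak phi + LV * c by apply: half => // t tD; rewrite distrC Hc.
rewrite [`|_ : R^o|]/(`|peak phi - peak psi|) ler_norml; apply/andP; split; lra.
Qed.

(** By uniqueness the solution started at [x_h] is the shift of [x], and the weight
of a term at time [t] after the shift is [e^{- lam h}] times its weight
before. *)
Lemma peak_flow phi h : hist Delta phi -> 0 <= h ->
  peak (seg (X phi) h) <= expR (- lam * h) * peak phi.
Proof.
move=> hp h0; have ip := X_solves hp; have [cx _] := ip.
have hs : hist Delta (seg (X phi) h) by exact: seg_hist.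
apply: peak_le => t tau t0 tD.
have -> : X (seg (X phi) h) (t + tau) = X phi (h + t + tau).
  rewrite -addrA; apply: (forward_solution_unique Delta_gt0 delay_bounds f_lip (X_solves hs)
    (forward_solution_shift h0 ip)); last by lra.
  by move=> s sD; rewrite X_init.
have H := peak_ge hp (addr_ge0 h0 t0) tD.
rewrite mulNr expRN [leRHS]mulrC ler_pdivlMr ?expR_gt0//.
apply: le_trans H; rewrite mulrDr expRD le_eqVlt; apply/orP; left; apply/eqP; ring.
Qed.

(** [peak_flow] bounds [peak] at the true history [x_h], and [phi_ext] may be
replaced by it up to [o(h)].  The rest is the expansion
[e^{- lam h} <= 1 - lam h + (lam h)^2]. *)
Lemma peak_Dplus phi : hist Delta phi ->
  (Dplus A delay f peak phi <= (- lam * N phi)%:E)%E.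
Proof.
move=> hp; have [LV [LV0 HLV]] := peak_lipschitz.
have P0 : N phi <= peak phi by exact: sup_norm_le_peak.
have N0 : 0 <= N phi by apply: sup_norm_ge0 hp; exact: ltW.
apply: (@le_trans _ _ (- lam * peak phi)%:E); last first.
  by rewrite lee_fin !mulNr lerN2 ler_pM2l.
apply: Dplus_le => e e0.
have e10 : 0 < e / (2 * (LV + 1)) by rewrite divr_gt0// mulr_gt0//; lra.
have [d d0 Hd] := phi_ext_consistent Delta_gt0 delay_bounds f_lip (X_solves hp) hp (X_init hp) e10.
pose d' := e / (2 * (lam ^+ 2 * (peak phi + 1))).
have l20 : 0 < lam ^+ 2 by rewrite exprn_gt0.
have d'0 : 0 < d' by rewrite divr_gt0// !mulr_gt0//; lra.
exists (Num.min d d'); first by rewrite lt_min d0.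
move=> h h0; rewrite lt_min => /andP[/(Hd h h0)[he Hclose] hd'].
have [cx _] := X_solves hp.
have H1 : peak (phi_ext A delay f phi h) <= peak (seg (X phi) h) + LV * (e / (2 * (LV + 1)) * h).
  suff : `|peak (phi_ext A delay f phi h) - peak (seg (X phi) h)| <= LV * (e / (2 * (LV + 1)) * h).
    by rewrite ler_norml => /andP[_]; lra.
  by apply: HLV => // [|t tD]; [exact: seg_hist|rewrite distrC; exact: Hclose].
have H2 := peak_flow hp (ltW h0).
have H3 : expR (- lam * h) <= 1 - lam * h + lam ^+ 2 * h ^+ 2.
  have lh : 0 < lam * h by rewrite mulr_gt0.
  rewrite mulNr expRN; apply: (@le_trans _ _ (1 + lam * h)^-1).
    by rewrite lef_pV2 ?posrE ?expR_gt0 ?expR_ge1Dx//; lra.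
  rewrite -[leLHS]mul1r ler_pdivrMr; last by lra.
  have : 0 < (lam * h) ^+ 3 by rewrite exprn_gt0.
  have -> : (1 - lam * h + lam ^+ 2 * h ^+ 2) * (1 + lam * h) = 1 + (lam * h) ^+ 3 by ring.
  lra.
have H4 : LV * (e / (2 * (LV + 1)) * h) <= e / 2 * h.
  have -> : LV * (e / (2 * (LV + 1)) * h) = LV / (LV + 1) * (e / 2 * h).
    by field; apply: lt0r_neq0; lra.
  rewrite ler_piMl ?mulr_ge0 ?divr_ge0 ?(ltW e0) ?(ltW h0)// ler_pdivrMr; lra.
have H5 : lam ^+ 2 * h ^+ 2 * peak phi <= e / 2 * h.
  have -> : lam ^+ 2 * h ^+ 2 * peak phi = lam ^+ 2 * peak phi * h * h by ring.
  rewrite ler_pM2r//; apply: (@le_trans _ _ (lam ^+ 2 * (peak phi + 1) * d')).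
    apply: ler_pM (ltW h0) _ (ltW hd').
      exact: mulr_ge0 (ltW l20) (le_trans N0 P0).
    by rewrite ler_pM2l// lerDl.
  rewrite /d' le_eqVlt; apply/orP; left; apply/eqP; field.
  by rewrite !lt0r_neq0//; lra.
have := ler_wpM2r (le_trans N0 P0) H3; lra.
Qed.

End Necessity.

Lemma zero_GES_lyapunov (R : realType) (n p : nat) (Delta : R) (delay : 'I_p -> R)
    (A : 'I_p -> 'M[R]_n) (f : (R -> 'cV[R]_n) -> 'cV[R]_n) (Lf : R) :
  (0 < n)%N -> 0 < Delta -> (forall j, 0 < delay j <= Delta) ->
  sup_lipschitz Delta f Lf -> zero_GES Delta A delay f ->
  exists (V Na : (R -> 'cV[R]_n) -> R) (a1 a2 a3 a4 : R),
    [/\ forall phi, hist Delta phi -> 0 <= V phi,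
        globally_lipschitz Delta (fun v : R => `|v|) V,
        seminorm_on_hist Delta Na,
        [/\ 0 < a1, 0 < a2, 0 < a3 & 0 < a4]
      & forall phi, hist Delta phi ->
        [/\ a1 * enorm (Dop A delay phi) <= V phi <= a2 * Na phi,
            (Dplus A delay f V phi <= (- a3 * Na phi)%:E)%E
          & Na phi <= a4 * hnorm Delta phi]].
Proof.
move=> n0 Delta_gt0 delay_bounds f_lip [M0 [l [M00 l0 HG]]].
have D0 := ltW Delta_gt0.
pose N := @sup_norm R n Delta.
pose M := (n%:R * M0 + 1) * expR (l * Delta).
have nM : 0 <= n%:R * M0 by rewrite mulr_ge0 ?(ltW M00).
have eD : 1 <= expR (l * Delta) by rewrite -expR0 ler_expR mulr_ge0 ?(ltW l0).
have M1 : 1 <= M by rewrite /M -[leLHS]mulr1 ler_pM ?ler01//; lra.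
pose lam := l / 2; have lam0 : 0 < lam by rewrite divr_gt0.
have /choice[X HX] phi : exists x, hist Delta phi ->
    [/\ forward_solution delay A f x, forall s, - Delta <= s <= 0 -> x s = phi s &
      neutral_solution Delta A delay f phi +oo%E x].
  have [hp|nhp] := pselect (hist Delta phi); last by exists (cst 0).
  by have [x Hx] := forward_solution_exists A Delta_gt0 delay_bounds f_lip hp; exists x.
have X_solves phi : hist Delta phi -> forward_solution delay A f (X phi) by move=> /HX[].
have X_init phi : hist Delta phi -> forall s, - Delta <= s <= 0 -> X phi s = phi s.
  by move=> /HX[].
have X_decay phi : hist Delta phi -> forall t tau, 0 <= t -> - Delta <= tau <= 0 ->
    `|X phi (t + tau)| <= M * expR (- (2 * lam) * t) * N phi.
  move=> hp t tau t0 tD.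
  have Np : 0 <= N phi by exact: sup_norm_ge0.
  have -> : 2 * lam = l by rewrite /lam; field.
  have [tt0|tt0] := leP 0 (t + tau).
    have [_ _ Hx] := HX _ hp; have [_ /(_ _ Hx _ tt0) H] := HG phi hp.
    apply: le_trans (norm_le_enorm _) _; apply: le_trans H _.
    apply: (@le_trans _ _ (M0 * (expR (l * Delta) * expR (- l * t)) * (n%:R * N phi))).
      apply: ler_pM; rewrite ?hnorm_ge0 ?mulr_ge0 ?(ltW M00) ?expR_ge0//.
        rewrite ler_pM2l// -expRD ler_expR.
        have -> : l * Delta + - l * t = - l * (t - Delta) by ring.
        by rewrite !mulNr lerN2 ler_pM2l//; lra.
      exact: hnorm_le_sup_norm.
    rewrite /M; have := mulr_ge0 (mulr_ge0 (expR_ge0 (l * Delta)) (expR_ge0 (- l * t))) Np.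
    lra.
  rewrite X_init//; last by lra.
  apply: le_trans (sup_norm_ge D0 hp _) _; first by lra.
  rewrite -/N -[leLHS]mul1r ler_wpM2r//.
  apply: (@le_trans _ _ (1 * (expR (l * Delta) * expR (- l * t)))).
    rewrite mul1r -expRD -expR0 ler_expR.
    have -> : l * Delta + - l * t = l * (Delta - t) by ring.
    by rewrite mulr_ge0 ?(ltW l0)//; lra.
  rewrite mulrA; apply: ler_wpM2r; first exact: expR_ge0.
  by rewrite ler_wpM2r ?expR_ge0// lerDr.
have K0 := @delay_gain_ge0 _ _ _ A.
have nK : 0 < n%:R * (1 + delay_gain A) by rewrite mulr_gt0 ?ltr0n//; lra.
pose V := peak Delta X lam.
have NV phi : hist Delta phi -> N phi <= V phi.
  exact: (sup_norm_le_peak Delta_gt0 M1 lam0 X_init X_decay).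
exists V, N, (n%:R * (1 + delay_gain A))^-1, M, lam, 1; split.
- by move=> phi hp; apply: le_trans (NV _ hp); exact: sup_norm_ge0.
- have [LV [LV0 HLV]] := peak_lipschitz Delta_gt0 delay_bounds f_lip M1 lam0
    X_solves X_init X_decay.
  exists (LV + 1) => [|phi psi h1 h2]; first by lra.
  have h12 := hist_sub D0 h1 h2.
  apply: (@le_trans _ _ (LV * hnorm Delta (phi - psi))).
    by apply: HLV => // t tD; exact: (norm_le_hnorm D0 h12 tD).
  by rewrite ler_wpM2r ?hnorm_ge0// lerDl.
- exact: sup_norm_seminorm.
- by rewrite invr_gt0 nK ltr01 (lt_le_trans ltr01 M1) lam0.
move=> phi hp; split.
- apply/andP; split; last exact: (peak_le_sup_norm Delta_gt0 M1 lam0 X_decay).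
  rewrite ler_pdivrMl// -mulrA; apply: le_trans (enorm_le _) _; rewrite ler_wpM2l//.
  apply: (norm_Dop_le A Delta_gt0 delay_bounds) => t tD.
  exact: le_trans (sup_norm_ge D0 hp tD) (NV _ hp).
- exact: (peak_Dplus Delta_gt0 delay_bounds f_lip M1 lam0 X_solves X_init X_decay hp).
- by rewrite mul1r; exact: sup_norm_le_hnorm.
Qed.

Unset Implicit Arguments.

Theorem theorem4 (R : realType) (n p : nat) (n_gt0 : (0 < n)%N)
    (p_gt0 : (0 < p)%N) (Delta : R) (Delta_gt0 : 0 < Delta)
    (delay : 'I_p -> R) (delay_bounds : forall j, 0 < delay j <= Delta)
    (A : 'I_p -> 'M[R]_n) (f : (R -> 'cV[R]_n) -> 'cV[R]_n)
    (f_lip : globally_lipschitz Delta (@enorm R n) f)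
    (f_0 : f (cst 0) = 0)
    (D_stable : strongly_stable A) :
  zero_GES Delta A delay f <->
  exists (V : (R -> 'cV[R]_n) -> R) (Na : (R -> 'cV[R]_n) -> R)
         (a1 a2 a3 a4 : R),
    [/\ forall phi, hist Delta phi -> 0 <= V phi,
        globally_lipschitz Delta (fun v : R => `|v|) V,
        seminorm_on_hist Delta Na,
        [/\ 0 < a1, 0 < a2, 0 < a3 & 0 < a4]
      & forall phi, hist Delta phi ->
        [/\ a1 * enorm (Dop A delay phi) <= V phi <= a2 * Na phi,
            (Dplus A delay f V phi <= (- a3 * Na phi)%:E)%E
          & Na phi <= a4 * hnorm Delta phi]].
Proof.
have [Lf flip] := sup_lipschitz_of_enorm Delta_gt0 f_lip.
split; first exact: (zero_GES_lyapunov n_gt0 Delta_gt0 delay_bounds flip).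
move=> [V [Na [a1 [a2 [a3 [a4 [V0 Vlip _ [a10 a20 a30 a40] HV]]]]]]].
apply: (lyapunov_zero_GES n_gt0 Delta_gt0 delay_bounds f_lip _ V0 Vlip a10 a20 a30 a40 HV).
by apply: D_stable => j; case/andP: (delay_bounds j).
Qed.
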